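(* Let $X$ be a measurable space, $\mathcal{H}$ a complex separable Hilbert space, and let $\mu$ be a $C^*$-extreme point in $\mathcal{P}_{\mathcal{H}}(X)$. Then there is an orthogonal decomposition $\mathcal{H}=\mathcal{H}_1\oplus\mathcal{H}_2$ into (possibly zero) closed subspaces such that $\mu=\mu_1\oplus\mu_2$, where $\mu_1\in\mathcal{P}_{\mathcal{H}_1}(X)$ is an atomic normalized POVM, $\mu_2\in\mathcal{P}_{\mathcal{H}_2}(X)$ is a non-atomic normalized POVM, and $\mu_1$ and $\mu_2$ are mutually singular. Such a decomposition is unique. Furthermore, $\mu_1$ is $C^*$-extreme in $\mathcal{P}_{\mathcal{H}_1}(X)$ and $\mu_2$ is $C^*$-extreme in $\mathcal{P}_{\mathcal{H}_2}(X)$, and in particular $\mu_1$ is a spectral measure.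
   Context: A measurable space is a nonempty set $X$ with a $\sigma$-algebra $\mathcal{O}(X)$ of subsets; all singletons are assumed measurable. $\mathcal{B}(\mathcal{H})$ denotes the bounded operators on $\mathcal{H}$; the inner product is linear in the second variable; a projection is a self-adjoint idempotent. A positive operator valued measure (POVM) on $X$ with values in $\mathcal{B}(\mathcal{H})$ is a map $\mu:\mathcal{O}(X)\to\mathcal{B}(\mathcal{H})$ with $\mu(A)\ge 0$ for all $A$ and such that for all $h,k\in\mathcal{H}$ the map $A\mapsto\langle h,\mu(A)k\rangle$ is a complex measure. It is normalized if $\mu(X)=I_{\mathcal{H}}$, and it is a spectral measure if it is normalized and every $\mu(A)$ is a projection. $\mathcal{P}_{\mathcal{H}}(X)$ is the set of all normalized POVMs on $X$ with values in $\mathcal{B}(\mathcal{H})$. The direct sum is $(\mu_1\oplus\mu_2)(A)=\mu_1(A)\oplus\mu_2(A)$. A set $A\in\mathcal{O}(X)$ is an atom for $\mu$ if $\mu(A)\ne 0$ and for every measurable $B\subseteq A$ either $\mu(B)=0$ or $\mu(B)=\mu(A)$. $\mu$ is atomic if every $A\in\mathcal{O}(X)$ with $\mu(A)\neq 0$ contains an atom for $\mu$; $\mu$ is non-atomic if it has no atom. Two POVMs $\mu_i:\mathcal{O}(X)\to\mathcal{B}(\mathcal{H}_i)$, $i=1,2$, are mutually singular if there are disjoint measurable subsets $X_1,X_2$ of $X$ with $\mu_i(A)=\mu_i(A\cap X_i)$ for all $A\in\mathcal{O}(X)$. A normalized POVM $\mu$ is a $C^*$-extreme point in $\mathcal{P}_{\mathcal{H}}(X)$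 if, whenever $\mu(\cdot)=\sum_{i=1}^n T_i^*\mu_i(\cdot)T_i$ with $\mu_i\in\mathcal{P}_{\mathcal{H}}(X)$ and invertible $T_i\in\mathcal{B}(\mathcal{H})$ satisfying $\sum_{i=1}^n T_i^*T_i=I_{\mathcal{H}}$, there are unitaries $U_i\in\mathcal{B}(\mathcal{H})$ such that $\mu_i(\cdot)=U_i^*\mu(\cdot)U_i$ for $1\le i\le n$. *)

(* Defs.v *)
From HB Require Import structures.
From mathcomp Require Import all_boot all_order all_algebra complex.
From mathcomp Require Import all_classical all_reals all_analysis.

Set Implicit Arguments.
Unset Strict Implicit.
Unset Printing Implicit Defensive.

Import Order.TTheory GRing.Theory Num.Theory.
Import numFieldNormedType.Exports.

Local Open Scope classical_set_scope.
Local Open Scope ring_scope.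

(* Complex Hilbert spaces; the inner product is linear in its second variable. *)
HB.mixin Record CompleteNormedModule_isHilbert (R : realType) H
    & CompleteNormedModule R[i] H := {
  inner : H -> H -> R[i] ;
  inner_linear : forall h : H, linear_for *%R (inner h) ;
  inner_conj : forall h k : H, (inner h k)^* = inner k h ;
  inner_norm : forall h : H, inner h h = `|h| ^+ 2
}.

#[short(type="hilbertType")]
HB.structure Definition Hilbert (R : realType) :=
  {H of CompleteNormedModule R[i] H & CompleteNormedModule_isHilbert R H}.

Definition separable_space (T : topologicalType) :=
  exists2 D : set T, countable D & dense D.

Section closed_subspace.
Context {R : realType} {H : hilbertType R}.

Record closed_subspace := ClosedSubspace {
  carrier : set H ;
  carrier_submod : submod_closed (mem carrier) ;
  carrier_closed : closed carrier }.

Definition in_csub (S : closed_subspace) : {pred H} := mem (carrier S).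

HB.instance Definition _ S :=
  GRing.isSubmodClosed.Build R[i] H (in_csub S) (carrier_submod S).

(* A closed subspace as a type, which inherits a Hilbert space structure. *)
Record csub (S : closed_subspace) := Csub {
  incl : H ;
  incl_in : in_csub S incl }.

End closed_subspace.
Arguments closed_subspace {R} H.
Arguments incl {R H S}.

Section csub_hilbert.
Context {R : realType} {H : hilbertType R} (S : closed_subspace H).

HB.instance Definition _ := [isSub for @incl R H S].
HB.instance Definition _ := [Choice of csub S by <:].
HB.instance Definition _ := [SubChoice_isSubLmodule of csub S by <:].

Let csub_norm (x : csub S) : R[i] := `|incl x|.

Let csub_norm_triangle x y : csub_norm (x + y) <= csub_norm x + csub_norm y.
Proof. exact: ler_normD. Qed.

Let csub_normZ (l : R[i]) x : csub_norm (l *: x) = `|l| * csub_norm x.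
Proof. exact: normrZ. Qed.

Let csub_norm0 x : csub_norm x = 0 -> x = 0.
Proof. by move=> /normr0_eq0 x0; apply/val_inj. Qed.

HB.instance Definition _ := Lmodule_isNormed.Build R[i] (csub S)
  csub_norm_triangle csub_normZ csub_norm0.

Let csub_complete (F : set_system (csub S)) :
  ProperFilter F -> cauchy F -> cvg F.
Proof.
move=> FF /(cauchyP F) Fc.
have inclFc : cauchy (@incl R H S @ F).
  apply: cauchy_exP => e /Fc[x Fx]; exists (incl x).
  rewrite -ball_normE; exact: Fx.
have /(@cvg_ex H)[l Fl] : cvg (@incl R H S @ F) by exact: cauchy_cvg.
have Sl : carrier S l.
  apply: (closed_cvg (carrier S) (@carrier_closed _ _ S) _ l Fl).
  by apply: nearW => x; have := incl_in x; rewrite /in_csub inE.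
have lS : in_csub S l by rewrite /in_csub inE.
apply/(@cvg_ex (csub S)); exists (Csub lS).
apply/(@cvgrPdist_lt _ (csub S)) => e e0.
by move/cvgrPdist_lt : Fl => /(_ e e0).
Qed.

HB.instance Definition _ := Uniform_isComplete.Build (csub S) csub_complete.

Let csub_inner (x y : csub S) : R[i] := inner (incl x) (incl y).

Let csub_inner_linear x : linear_for *%R (csub_inner x).
Proof. by move=> a y z; rewrite /csub_inner -inner_linear. Qed.

Let csub_inner_conj x y : (csub_inner x y)^* = csub_inner y x.
Proof. exact: inner_conj. Qed.

Let csub_inner_norm x : csub_inner x x = `|x| ^+ 2.
Proof. exact: inner_norm. Qed.

HB.instance Definition _ := CompleteNormedModule_isHilbert.Build R (csub S)
  csub_inner_linear csub_inner_conj csub_inner_norm.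

End csub_hilbert.

Section bounded_operators.
Context {R : realType} {H : hilbertType R}.
Implicit Types T S U P : H -> H.

Definition bounded_op T :=
  linear T /\ exists M : R[i], forall h, `|T h| <= M * `|h|.

(* The adjoint of a bounded operator, which exists and is unique by the Riesz
   representation theorem; the default value is irrelevant. *)
Definition adj T : H -> H := xget (fun=> 0)
  [set S | bounded_op S /\ forall h k, inner h (T k) = inner (S h) k].

Definition positive_op T := forall h, 0 <= inner h (T h).

Definition projection P := [/\ bounded_op P, adj P = P & P \o P = P].

Definition invertible T := bounded_op T /\
  exists S, [/\ bounded_op S, S \o T = id & T \o S = id].

Definition unitary U := [/\ bounded_op U, adj U \o U = id & U \o adj U = id].

End bounded_operators.

Section complex_measure.
Context {d : measure_display} {X : measurableType d} {R : realType}.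

Definition complex_measure (m : set X -> R[i]) :=
  forall A : (set X)^nat, (forall n, measurable (A n)) -> trivIset setT A ->
    (fun n => \sum_(i < n) m (A i) : R[i]^o) @ \oo
      --> (m (\bigcup_n A n) : R[i]^o).

End complex_measure.

Section povm.
Context {d : measure_display} {X : measurableType d} {R : realType}
  {H : hilbertType R}.
(* Only the values on measurable sets are meaningful. *)
Implicit Types mu : set X -> H -> H.

Definition povm mu :=
  (forall A, measurable A -> bounded_op (mu A) /\ positive_op (mu A)) /\
  (forall h k, complex_measure (fun A => inner h (mu A k))).

Definition normalized_povm mu := povm mu /\ mu setT = id.

Definition spectral_measure mu :=
  normalized_povm mu /\ forall A, measurable A -> projection (mu A).

Definition atom mu (A : set X) := [/\ measurable A, mu A <> (fun=> 0) &
  forall B, measurable B -> B `<=` A -> mu B = (fun=> 0) \/ mu B = mu A].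

Definition atomic mu := forall A, measurable A -> mu A <> (fun=> 0) ->
  exists2 B, B `<=` A & atom mu B.

Definition nonatomic mu := forall A, ~ atom mu A.

Definition Cstar_extreme mu := normalized_povm mu /\
  forall (n : nat) (nu : 'I_n -> set X -> H -> H) (T : 'I_n -> H -> H),
    (forall i, normalized_povm (nu i)) ->
    (forall i, invertible (T i)) ->
    (forall h, \sum_(i < n) adj (T i) (T i h) = h) ->
    (forall A, measurable A -> forall h,
      mu A h = \sum_(i < n) adj (T i) (nu i A (T i h))) ->
  exists U : 'I_n -> H -> H, forall i, unitary (U i) /\
    forall A, measurable A -> nu i A = adj (U i) \o mu A \o U i.

End povm.

Definition mutually_singular {d : measure_display} {X : measurableType d}
    {R : realType} {H1 H2 : hilbertType R}
    (mu1 : set X -> H1 -> H1) (mu2 : set X -> H2 -> H2) :=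
  exists X1 X2 : set X,
    [/\ measurable X1, measurable X2, X1 `&` X2 = set0 &
       forall A, measurable A ->
         mu1 A = mu1 (A `&` X1) /\ mu2 A = mu2 (A `&` X2)].

Section decomposition.
Context {d : measure_display} {X : measurableType d} {R : realType}
  {H : hilbertType R}.

Definition orthogonal_decomposition (H1 H2 : closed_subspace H) :=
  (forall (h1 : csub H1) (h2 : csub H2), inner (incl h1) (incl h2) = 0) /\
  (forall h : H, exists (h1 : csub H1) (h2 : csub H2), h = incl h1 + incl h2).

Definition povm_direct_sum (H1 H2 : closed_subspace H) (mu : set X -> H -> H)
    (mu1 : set X -> csub H1 -> csub H1) (mu2 : set X -> csub H2 -> csub H2) :=
  forall A, measurable A -> forall (h1 : csub H1) (h2 : csub H2),
    mu A (incl h1 + incl h2) = incl (mu1 A h1) + incl (mu2 A h2).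

Definition atomic_nonatomic_decomposition (mu : set X -> H -> H)
    (H1 H2 : closed_subspace H)
    (mu1 : set X -> csub H1 -> csub H1) (mu2 : set X -> csub H2 -> csub H2) :=
  [/\ orthogonal_decomposition H1 H2,
      povm_direct_sum mu mu1 mu2,
      normalized_povm mu1 /\ atomic mu1,
      normalized_povm mu2 /\ nonatomic mu2 &
      mutually_singular mu1 mu2].

(* Equality of two families of operators on closed subspaces, on measurable
   sets: the subspaces coincide as subsets of [H], and the operators act in the
   same way on them. *)
Definition same_povm (H1 K1 : closed_subspace H)
    (mu : set X -> csub H1 -> csub H1) (nu : set X -> csub K1 -> csub K1) :=
  carrier H1 = carrier K1 /\
  forall A, measurable A -> forall (h : csub H1) (k : csub K1),
    incl h = incl k -> incl (mu A h) = incl (nu A k).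

End decomposition.

(* Main.v *)
Require Import Defs.
From mathcomp Require Import all_boot all_order all_algebra complex.
From mathcomp Require Import all_classical all_reals all_analysis.
From mathcomp Require Import ring lra.

Set Implicit Arguments.
Unset Strict Implicit.
Unset Printing Implicit Defensive.

Import Order.TTheory GRing.Theory Num.Theory.
Import numFieldNormedType.Exports.
Local Open Scope classical_set_scope.
Local Open Scope ring_scope.

Local Notation Re := complex.Re.
Local Notation Im := complex.Im.
Local Notation toC := (real_complex _).
Local Notation incl := Defs.incl.

(** Everything rests on one fact: if [mu] is C*-extreme on a separable space
and [A] is an atom, then [T = mu A] is a projection ([extreme_atom_idem]).
Suppose it is not. Maximising <h, (T - T^2) h> produces a number t0 strictly
between 0 and 1 which is an approximate eigenvalue of [T]
([near_eigenvalue_exists]). For every t slightly below t0 the operator T/2 can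
be perturbed by a small rank-one operator c<e,.>e so that the perturbed
operator and 1/2 + c<e,.>e have t as a generalised eigenvalue
([rank_one_perturbation]). Since [A] is an atom, the measurable subsets of [A]
only see a 0-1 measure, so this perturbation splits [mu] into two positive
measures, mu/2 + c<e,.>e and mu/2 - c<e,.>e on [A], and C*-extremality makes
each of them equivalent to [mu] ([extreme_rank_one]); the square roots of
1/2 + c<e,.>e and 1/2 - c<e,.>e that this requires are explicit, because these
operators are a scalar plus a rank-one operator. Hence t is a genuine
eigenvalue of [T]. An interval of eigenvalues of a self-adjoint operator
contradicts separability ([countable_eigenvalues]).

Once atoms take projections as values, the values at two atoms are either equal
or orthogonal projections, so by separability only countably many values occur;
the union [Y] of one atom for each value carries all atoms up to null sets
([carries_atoms_exists]), and [mu] takes projections as values on the subsets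
of [Y], by countable additivity. So [mu Y] commutes with [mu], and compressing
[mu] to the ranges of [mu Y] and [mu (~` Y)] gives the decomposition
([range_decomposition]). Conversely, the set on which the atomic summand of any
decomposition lives has the same property as [Y], which determines [mu Y]
([carries_atoms_unique]) and so the decomposition ([decomposition_unique]).

C*-extremality passes to the compressions ([compress_extreme]): a C*-convex
combination giving one summand is completed by the other summand with equal
weights to a combination giving [mu], and mutual singularity forces the
resulting unitaries to commute with [mu Y], hence to split. *)

(** * Inner products over the complex numbers *)

Section real_facts.
Context {R : realType}.

(** A nonnegative quadratic polynomial has nonpositive discriminant; the form
in which every Cauchy-Schwarz inequality below is obtained. *)
Lemma discriminant_le (a b c : R) :
  (forall t : R, 0 <= a + t * b *+ 2 + t ^+ 2 * c) -> b ^+ 2 <= a * c.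
Proof.
move=> q_ge0; have a0 : 0 <= a by have := q_ge0 0; lra.
have [c_le0|c_gt0] := leP c 0.
  have c0 : c = 0.
    apply/eqP; rewrite eq_le c_le0 /= leNgt; apply/negP => c_lt0.
    (* a point beyond 1 where the leading term dominates the other two *)
    have := q_ge0 (- (a + 1 + `|b|*+2 ) / c * 1 + 1).
    set t := _ + 1.
    have tc : t * c = c - (a + 1 + `|b| *+ 2) by rewrite /t; field; lra.
    have t1 : 1 <= t.
      rewrite /t mulr1 lerDr; apply: mulr_le0; last by rewrite invr_le0; lra.
      have := normr_ge0 b; lra.
    have := ler_norm b; have := normr_ge0 b; rewrite expr2 -mulrA tc; nra.
  rewrite c0 mulr0; have [->|b0] := eqVneq b 0; first by rewrite expr0n.
  have := q_ge0 (- (a + 1) / (b *+ 2)).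
  rewrite c0 mulr0 addr0 (_ : _ / _ * _ *+ 2 = - (a + 1)); last by field.
  lra.
have := q_ge0 (- b / c).
rewrite (_ : _ + _ = (a * c - b ^+ 2) / c); last by field; lra.
by rewrite pmulr_lge0 ?invr_gt0 // subr_ge0.
Qed.

Lemma Re0 : Re (0 : R[i]) = 0. Proof. by []. Qed.
Lemma ReD (x y : R[i]) : Re (x + y) = Re x + Re y.
Proof. by case: x y => [? ?] [? ?]. Qed.
Lemma ReN (x : R[i]) : Re (- x) = - Re x.
Proof. by case: x. Qed.
Lemma ReB (x y : R[i]) : Re (x - y) = Re x - Re y.
Proof. by rewrite ReD ReN. Qed.
Lemma ReZ (a : R) (x : R[i]) : Re (toC a * x) = a * Re x.
Proof. by case: x => ? ?; rewrite /= mul0r subr0. Qed.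
Lemma Re_conj (x : R[i]) : Re (x^*) = Re x.
Proof. by case: x. Qed.
Lemma conj_toC (a : R) : (toC a)^* = toC a.
Proof. by rewrite /Num.conj /= oppr0. Qed.

Lemma toC_Re (z : R[i]) : 0 <= z -> z = toC (Re z).
Proof. by case: z => a b; rewrite lecE /= => /andP[/eqP -> _]. Qed.

End real_facts.

Section inner_product.
Context {R : realType} {H : hilbertType R}.
Implicit Types (h k x y : H).

Lemma innerDr h x y : inner h (x + y) = inner h x + inner h y.
Proof. by have := inner_linear h 1 x y; rewrite scale1r mul1r. Qed.

Lemma inner0r h : inner h 0 = 0.
Proof. by apply: (addrI (inner h 0)); rewrite -innerDr !addr0. Qed.

Lemma innerZr h a x : inner h (a *: x) = a * inner h x.
Proof. by have := inner_linear h a x 0; rewrite addr0 inner0r addr0. Qed.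

Lemma innerNr h x : inner h (- x) = - inner h x.
Proof. by rewrite -scaleN1r innerZr mulN1r. Qed.

Lemma innerBr h x y : inner h (x - y) = inner h x - inner h y.
Proof. by rewrite innerDr innerNr. Qed.

Lemma innerDl h x y : inner (x + y) h = inner x h + inner y h.
Proof. by rewrite -inner_conj innerDr rmorphD /= !inner_conj. Qed.

Lemma innerZl h a x : inner (a *: x) h = a^* * inner x h.
Proof. by rewrite -inner_conj innerZr rmorphM /= inner_conj. Qed.

Lemma innerNl h x : inner (- x) h = - inner x h.
Proof. by rewrite -inner_conj innerNr rmorphN /= inner_conj. Qed.

Lemma innerBl h x y : inner (x - y) h = inner x h - inner y h.
Proof. by rewrite innerDl innerNl. Qed.

Lemma inner_sumr I (r : seq I) (P : pred I) (F : I -> H) h :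
  inner h (\sum_(i <- r | P i) F i) = \sum_(i <- r | P i) inner h (F i).
Proof. by apply: big_morph; [exact: innerDr|exact: inner0r]. Qed.

(** The underlying real inner product. Estimates are carried out with it and
with squared norms, since the reals are totally ordered while the norm of a
complex space takes complex values. *)
Definition rdot h k : R := Re (inner h k).
Definition nsq h : R := rdot h h.

Lemma inner_nsq h : inner h h = toC (nsq h).
Proof. by rewrite /nsq /rdot -toC_Re// inner_norm exprn_ge0. Qed.

Lemma rdotC h k : rdot h k = rdot k h.
Proof. by rewrite /rdot -inner_conj Re_conj. Qed.

Lemma rdotDr h x y : rdot h (x + y) = rdot h x + rdot h y.
Proof. by rewrite /rdot innerDr ReD. Qed.
Lemma rdotDl h x y : rdot (x + y) h = rdot x h + rdot y h.
Proof. by rewrite /rdot innerDl ReD. Qed.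
Lemma rdotBr h x y : rdot h (x - y) = rdot h x - rdot h y.
Proof. by rewrite /rdot innerBr ReB. Qed.
Lemma rdotBl h x y : rdot (x - y) h = rdot x h - rdot y h.
Proof. by rewrite /rdot innerBl ReB. Qed.
Lemma rdotZr h (a : R) x : rdot h (toC a *: x) = a * rdot h x.
Proof. by rewrite /rdot innerZr ReZ. Qed.
Lemma rdotZl h (a : R) x : rdot (toC a *: x) h = a * rdot x h.
Proof. by rewrite rdotC rdotZr rdotC. Qed.
Lemma rdotNr h x : rdot h (- x) = - rdot h x.
Proof. by rewrite /rdot innerNr ReN. Qed.
Lemma rdotNl h x : rdot (- x) h = - rdot x h.
Proof. by rewrite /rdot innerNl ReN. Qed.
Lemma rdot0r h : rdot h 0 = 0. Proof. by rewrite /rdot inner0r. Qed.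

Definition rdotE := (rdotDr, rdotDl, rdotNr, rdotNl, rdotZr, rdotZl).

Lemma sqr_norm_nsq h : `|h| ^+ 2 = toC (nsq h).
Proof. by rewrite -inner_norm inner_nsq. Qed.

Lemma nsq_ge0 h : 0 <= nsq h.
Proof. by rewrite -ler0c -sqr_norm_nsq exprn_ge0. Qed.

Lemma nsq_eq0 h : nsq h = 0 -> h = 0.
Proof.
move=> h0; apply/eqP; rewrite -normr_eq0 -sqrf_eq0 sqr_norm_nsq h0.
by rewrite eqxx.
Qed.

Lemma nsq_gt0 h : h <> 0 -> 0 < nsq h.
Proof.
move=> h0; rewrite lt_neqAle nsq_ge0 andbT eq_sym; apply/eqP => /nsq_eq0.
exact: h0.
Qed.

Lemma nsqZ (a : R[i]) h : toC (nsq (a *: h)) = `|a| ^+ 2 * toC (nsq h).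
Proof. by rewrite -!sqr_norm_nsq normrZ exprMn. Qed.

Lemma nsqZr (a : R) h : nsq (toC a *: h) = a ^+ 2 * nsq h.
Proof. by rewrite /nsq rdotZl rdotZr; ring. Qed.

Lemma nsqN h : nsq (- h) = nsq h.
Proof. by rewrite /nsq rdotNl rdotNr opprK. Qed.

Lemma nsqD h k : nsq (h + k) = nsq h + rdot h k *+ 2 + nsq k.
Proof. by rewrite /nsq !rdotE (rdotC k h); ring. Qed.

Lemma nsqB h k : nsq (h - k) = nsq h - rdot h k *+ 2 + nsq k.
Proof. by rewrite /nsq !rdotE (rdotC k h); ring. Qed.

Lemma inner_ext x y : (forall h, inner h x = inner h y) -> x = y.
Proof.
move=> xy; apply/eqP; rewrite -subr_eq0; apply/eqP/nsq_eq0.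
by rewrite /nsq /rdot innerBr xy subrr.
Qed.

Lemma norm_lt_nsq h (r : R) : 0 < r -> (`|h| < toC r) = (nsq h < r ^+ 2).
Proof.
move=> r0; rewrite -(ltr_pXn2r (n := 2)) ?nnegrE ?normr_ge0 ?ler0c 1?ltW//.
by rewrite sqr_norm_nsq -rmorphXn /= ltcR.
Qed.

Lemma norm_le_nsq h (r : R) k : 0 <= r ->
  (`|h| <= toC r * `|k|) = (nsq h <= r ^+ 2 * nsq k).
Proof.
move=> r0.
rewrite -(ler_pXn2r (n := 2)) ?nnegrE ?mulr_ge0 ?normr_ge0 ?ler0c//.
by rewrite exprMn !sqr_norm_nsq -rmorphXn -rmorphM /= lecR.
Qed.

End inner_product.

Section operators.
Context {R : realType} {H : hilbertType R}.
Implicit Types (T S : H -> H) (h k x y : H).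

Lemma linD T : linear T -> forall x y, T (x + y) = T x + T y.
Proof. by move=> lT x y; have := lT 1 x y; rewrite !scale1r. Qed.

Lemma lin0 T : linear T -> T 0 = 0.
Proof. by move=> lT; apply: (addrI (T 0)); rewrite -linD// !addr0. Qed.

Lemma linZ T : linear T -> forall a x, T (a *: x) = a *: T x.
Proof. by move=> lT a x; have := lT a x 0; rewrite addr0 lin0// addr0. Qed.

Lemma linN T : linear T -> forall x, T (- x) = - T x.
Proof. by move=> lT x; rewrite -scaleN1r linZ// scaleN1r. Qed.

Lemma linB T : linear T -> forall x y, T (x - y) = T x - T y.
Proof. by move=> lT x y; rewrite linD// linN. Qed.

(** Boundedness with a real constant and squared norms, which is the form used
in all estimates. *)
Lemma bounded_opP T : bounded_op T <->
  linear T /\ exists c : R, 0 <= c /\ forall h, nsq (T h) <= c * nsq h.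
Proof.
split=> -[lT]; last first.
  case=> c [c0 Tc]; split=> //; exists (toC (Num.sqrt c)) => h.
  by rewrite norm_le_nsq ?sqrtr_ge0// sqr_sqrtr.
case=> M TM; split=> //; exists (Re `|M| ^+ 2); split; first exact: sqr_ge0.
move=> h; rewrite -norm_le_nsq; last by rewrite -ler0c -toC_Re.
rewrite -toC_Re//; have := TM h => TMh.
have : `|M * `|h| | = M * `|h| by apply: ger0_norm; apply: le_trans TMh.
by rewrite normrM normr_id => ->.
Qed.

Definition selfadj T := forall h k, inner h (T k) = inner (T h) k.

Lemma selfadj_inner T : selfadj T -> forall h, inner h (T h) = toC (rdot h (T h)).
Proof.
move=> sT h; have := inner_conj h (T h); rewrite /rdot -sT.
case: (inner _ _) => a b [] /= bN; congr Complex; lra.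
Qed.

Lemma rdot_selfadj T : selfadj T -> forall h k, rdot h (T k) = rdot (T h) k.
Proof. by move=> sT h k; rewrite /rdot sT. Qed.

End operators.

(** * Positive operators, the Riesz theorem and adjoints *)

Section positive_operators.
Context {R : realType} {H : hilbertType R}.
Implicit Types (T S : H -> H) (h k x y : H).

(** Polarisation: the real quadratic form at [h + k] and at [h + i k] forces
the sesquilinear form to be hermitian. *)
Lemma positive_selfadj T : linear T -> positive_op T -> selfadj T.
Proof.
move=> lT pT h k.
have ImB x : Im (inner x (T x)) = 0 by rewrite (toC_Re (pT x)).
have := ImB (h + k); have := ImB (h + 'i%C *: k).
rewrite !(linD lT) (linZ lT) !(innerDr, innerDl, innerZr, innerZl).
rewrite -(inner_conj k (T h)).
have := ImB h; have := ImB k.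
case: (inner h (T h)) => a1 b1; case: (inner k (T k)) => a2 b2.
case: (inner h (T k)) => a3 b3; case: (inner k (T h)) => a4 b4 /=.
move=> -> -> e1 e2; congr Complex; lra.
Qed.

Lemma rdot_ge0 T : positive_op T -> forall h, 0 <= rdot h (T h).
Proof. by move=> pT h; rewrite -ler0c -toC_Re. Qed.

Lemma selfadj_positive T : selfadj T -> (forall h, 0 <= rdot h (T h)) ->
  positive_op T.
Proof. by move=> sT T0 h; rewrite (selfadj_inner sT) ler0c. Qed.

Lemma rdot_CS T : linear T -> positive_op T -> forall h k,
  rdot h (T k) ^+ 2 <= rdot h (T h) * rdot k (T k).
Proof.
move=> lT pT h k; apply: discriminant_le => t.
have sT := positive_selfadj lT pT.
have := rdot_ge0 pT (h + toC t *: k).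
rewrite (linD lT) (linZ lT) !rdotE (rdot_selfadj sT k h) (rdotC (T k) h).
by congr (_ <= _); ring.
Qed.

Lemma rdot_CS1 h k : rdot h k ^+ 2 <= nsq h * nsq k.
Proof.
apply: (@rdot_CS id) => // x /=.
by rewrite inner_nsq ler0c nsq_ge0.
Qed.

Definition modsq (z : R[i]) : R := Re z ^+ 2 + Im z ^+ 2.

(** The complex inequality follows from the real one after rotating [h] by the
phase of the inner product. *)
Lemma inner_CS T : linear T -> positive_op T -> forall h k,
  modsq (inner h (T k)) <= rdot h (T h) * rdot k (T k).
Proof.
move=> lT pT h k; set z := inner h (T k).
have := rdot_CS lT pT (z *: h) k.
rewrite (linZ lT) {1 2}/rdot !(innerZl, innerZr) -/z.
rewrite (selfadj_inner (positive_selfadj lT pT)).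
have -> : Re (z^* * z) = modsq z by rewrite /modsq; case: (z) => a b /=; ring.
have -> : Re (z * (z^* * toC (rdot h (T h)))) = modsq z * rdot h (T h).
  by rewrite /modsq; case: (z) => a b /=; ring.
rewrite -mulrA expr2.
have : 0 <= modsq z by rewrite addr_ge0// sqr_ge0.
rewrite le_eqVlt => /predU1P[<- _|z0]; first by rewrite mulr_ge0// rdot_ge0.
by rewrite ler_pM2l.
Qed.

Lemma positive_eq0 T : linear T -> positive_op T ->
  forall h, rdot h (T h) = 0 -> T h = 0.
Proof.
move=> lT pT h h0; apply: nsq_eq0; apply/eqP; rewrite -sqrf_eq0.
rewrite eq_le sqr_ge0 andbT; apply: le_trans (rdot_CS lT pT (T h) h) _.
by rewrite h0 mulr0.
Qed.

(** The inequality T^2 <= c T for 0 <= T <= c, from Cauchy-Schwarz for the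
form of [T] at [T h] and [h]. *)
Lemma nsq_le_rdot T (c : R) : 0 <= c -> linear T -> positive_op T ->
  (forall h, rdot h (T h) <= c * nsq h) ->
  forall h, nsq (T h) <= c * rdot h (T h).
Proof.
move=> c0 lT pT Tc h; have := rdot_CS lT pT (T h) h; rewrite -/(nsq (T h)).
have := Tc (T h); have := nsq_ge0 (T h); have := rdot_ge0 pT h.
move: (rdot _ _) (nsq _) (rdot _ (T (T h))) => a b e a0.
rewrite le_eqVlt => /predU1P[<- e0 _|b0 eb be]; first exact: mulr_ge0.
rewrite -(ler_pM2l b0) -expr2; apply: le_trans be _.
by have := ler_wpM2r a0 eb; congr (_ <= _); ring.
Qed.

End positive_operators.

Section riesz.
Context {R : realType} {H : hilbertType R}.
Variables (g : H -> R) (c : R).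
Hypothesis gD : forall x y, g (x + y) = g x + g y.
Hypothesis gZ : forall (a : R) x, g (toC a *: x) = a * g x.
Hypothesis c_ge0 : 0 <= c.
Hypothesis g_bounded : forall x, g x ^+ 2 <= c * nsq x.

(** The functional to minimise: the representing vector of [g] is its unique
minimiser. *)
Let J h := nsq h - g h *+ 2.

Let J_bound h : - c <= J h.
Proof.
rewrite /J; have := g_bounded h; have := nsq_ge0 h.
have c0 := c_ge0; move: (nsq h) (g h) => n x n0 xcn; rewrite leNgt; apply/negP => lt.
have p1 : 0 < x *+ 2 - (n + c) by lra.
have p2 : 0 < x *+ 2 + (n + c) by lra.
have := mulr_gt0 p1 p2; have := sqr_ge0 (n - c); nra.
Qed.

Let has_infJ : has_inf (range J).
Proof.
split; first by exists (J 0), 0.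
by exists (- c) => _ [h _ <-]; exact: J_bound.
Qed.

Let J_near (e : R) : 0 < e -> exists h, forall k, J h <= J k + e.
Proof.
move=> e0; have [_ [h _ <-] Jh] := inf_adherent e0 has_infJ.
exists h => k; apply: le_trans (ltW Jh) _; rewrite lerD2r.
by apply: ge_inf; [case: has_infJ|exists k].
Qed.

(** At a point which is minimal up to [e], the first variation of [J] is
controlled by [e]; this makes minimising sequences Cauchy without the
parallelogram law, and identifies their limit. *)
Let near_min h (e : R) : (forall k, J h <= J k + e) ->
  forall k, (rdot h k - g k) ^+ 2 <= e * nsq k.
Proof.
move=> Jh k; apply: discriminant_le => t.
have := Jh (h + toC t *: k); rewrite /J nsqD rdotZr nsqZr gD gZ.
by rewrite -subr_ge0; congr (_ <= _); ring.
Qed.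

Lemma riesz_real : exists h, forall k, rdot h k = g k.
Proof.
have e_gt0 n : (0 : R) < n.+1%:R^-1 by rewrite invr_gt0.
pose u n := projT1 (cid (J_near (e_gt0 n))).
have uP n k : (rdot (u n) k - g k) ^+ 2 <= n.+1%:R^-1 * nsq k.
  by apply: near_min; rewrite /u; case: cid.
have u_close n m : nsq (u n - u m) <= (n.+1%:R^-1 + m.+1%:R^-1) *+ 2.
  set k := u n - u m; have := uP n k; have := uP m k.
  have : nsq k = (rdot (u n) k - g k) - (rdot (u m) k - g k).
    by rewrite {1}/nsq {1}/k rdotBl; ring.
  have := nsq_ge0 k; move: (nsq k) (rdot (u n) k - g k) (rdot (u m) k - g k).
  move=> z x y z0 zxy y2 x2.
  move: z0; rewrite le_eqVlt => /predU1P[<-|z0].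
    by rewrite mulrn_wge0// addr_ge0// ltW.
  rewrite -(ler_pM2r z0); apply: le_trans (_ : (x ^+ 2 + y ^+ 2) *+ 2 <= _).
    by rewrite [in leLHS]zxy -subr_ge0; have := sqr_ge0 (x + y);
      congr (_ <= _); ring.
  by have := lerD x2 y2; rewrite -mulrDl -(ler_pMn2r (n := 2))// mulrnAl.
have small (e : R) : 0 < e -> exists N, forall n, (N <= n)%N -> n.+1%:R^-1 < e.
  move=> e0; exists (Num.trunc e^-1) => n Nn.
  rewrite invf_plt ?posrE// (lt_le_trans (truncnS_gt _))// ler_nat ltnS//.
have cu : cauchy (u @ \oo).
  apply: cauchy_exP => e e0.
  have eE : e = toC (Re e) by apply: toC_Re; exact: ltW.
  have Re0 : 0 < Re e by rewrite -ltcR -eE.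
  have [N NP] := small (Re e ^+ 2 / 4) ltac:(by rewrite divr_gt0// exprn_gt0).
  exists (u N); exists N => // n /= Nn; rewrite -ball_normE /ball_ /= eE.
  rewrite norm_lt_nsq//; apply: le_lt_trans (u_close _ _) _.
  have := NP _ Nn; have := NP _ (leqnn N).
  move: (N.+1%:R^-1) (n.+1%:R^-1) (Re e ^+ 2) => a b r; lra.
have /(@cvg_ex H)[l ul] : cvg (u @ \oo) by exact: cauchy_cvg.
exists l => k; apply/eqP; rewrite -subr_eq0 -sqrf_eq0 eq_le sqr_ge0 andbT.
apply/ler_addgt0Pr => e; rewrite add0r -[_ e]/(0 < (e : R)) => e0.
have k1 : 0 < nsq k + 1 by have := nsq_ge0 k; lra.
pose e' : R := e / (nsq k + 1) / 4.
have e'0 : 0 < e' by rewrite !divr_gt0.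
have [N NP] := small _ e'0.
have /cvgrPdist_lt/(_ (toC (Num.sqrt e'))) := ul.
rewrite ltcR sqrtr_gt0 => /(_ e'0)[M _ MP].
have := MP (maxn M N) (leq_maxl _ _); rewrite /= norm_lt_nsq ?sqrtr_gt0//.
rewrite sqr_sqrtr ?(ltW e'0)//; set n := maxn M N => ln.
have := NP n (leq_maxr _ _); have := uP n k.
have := rdot_CS1 (l - u n) k; rewrite rdotBl.
have ee : e = e' * (nsq k + 1) * 4 by rewrite /e'; field; lra.
have := nsq_ge0 k; have := nsq_ge0 (l - u n).
move: ln; rewrite ee; move: (nsq _) (nsq _) (rdot _ _) (rdot _ _) (g k) (n.+1%:R^-1).
move=> a b x y z w ae a0 b0 h1 h2 we.
have := ler_wpM2r b0 (ltW ae); have := ler_wpM2r b0 (ltW we).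
have := sqr_ge0 ((y - x) - (x - z)); clearbody e'; nra.
Qed.

End riesz.

Section adjoint.
Context {R : realType} {H : hilbertType R}.
Implicit Types (T S : H -> H) (h k x y : H).

(** A complex functional is determined by its real part, so that the real
representation theorem suffices. *)
Lemma riesz (f : H -> R[i]) (c : R) : linear_for *%R f -> 0 <= c ->
  (forall x, modsq (f x) <= c * nsq x) ->
  exists h, forall k, inner h k = f k.
Proof.
move=> lf c0 fc.
have fD x y : f (x + y) = f x + f y by have := lf 1 x y; rewrite scale1r mul1r.
have f0 : f 0 = 0 by apply: (addrI (f 0)); rewrite -fD !addr0.
have fZ a x : f (a *: x) = a * f x by have := lf a x 0; rewrite !addr0 f0 addr0.
have [||//|x|h hP] := @riesz_real R H (fun x => Re (f x)) c.
- by move=> x y; rewrite fD ReD.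
- by move=> a x; rewrite fZ ReZ.
- by apply: le_trans (fc x); rewrite lerDl sqr_ge0.
exists h => k; have := hP k; have := hP ('i%C *: k).
rewrite /rdot innerZr fZ; case: (inner h k) (f k) => a b [a' b'] /=.
by move=> e1 e2; congr Complex; lra.
Qed.

(** The adjoint at [h] represents the functional sending [k] to <h, T k>. *)
Lemma adjoint_exists T : bounded_op T ->
  exists S, bounded_op S /\ forall h k, inner h (T k) = inner (S h) k.
Proof.
move=> /bounded_opP[lT [c [c0 Tc]]].
have /choice[S SP] : forall h, exists x, forall k, inner x k = inner h (T k).
  move=> h; apply: (@riesz _ (c * nsq h)) => [a x y||x].
  - by rewrite lT innerDr innerZr.
  - by rewrite mulr_ge0// nsq_ge0.
  have := @inner_CS _ H id _ _ h (T x); rewrite -!/(nsq _) => CS.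
  apply: le_trans (CS _ _) _ => // [y|].
    by rewrite inner_nsq ler0c nsq_ge0.
  by rewrite -!/(nsq _) mulrAC [leRHS]mulrC ler_wpM2l// nsq_ge0.
exists S; split=> //; apply/bounded_opP; split.
  move=> a x y; apply: inner_ext => h; rewrite -[LHS]inner_conj -[RHS]inner_conj.
  by rewrite SP !(innerDl, innerZl) !SP.
exists c; split=> // h.
have := rdot_CS1 h (T (S h)); rewrite /rdot -SP -/(rdot _ _) -/(nsq _).
have := Tc (S h); have := nsq_ge0 (S h); have := nsq_ge0 h.
move: (nsq _) (nsq _) (nsq _) => a b e a0.
rewrite le_eqVlt => /predU1P[<- _ _|b0 eb be]; first exact: mulr_ge0.
by rewrite -(ler_pM2r b0) -expr2; nra.
Qed.

Lemma adjP T : bounded_op T ->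
  bounded_op (adj T) /\ forall h k, inner h (T k) = inner (adj T h) k.
Proof.
move=> /adjoint_exists[S SP]; rewrite /adj; case: xgetP => [_ _ //|/(_ S)].
by case.
Qed.

Lemma adj_inner T h k :
  bounded_op T -> inner h (adj T k) = inner (T h) k.
Proof. by move=> bT; rewrite -inner_conj -(adjP bT).2 inner_conj. Qed.

Lemma adj_unique T S : bounded_op T ->
  (forall h k, inner h (T k) = inner (S h) k) -> adj T = S.
Proof.
move=> bT TS; apply/funext => x; apply: inner_ext => h.
by rewrite -[LHS]inner_conj -[RHS]inner_conj -TS -(adjP bT).2.
Qed.

End adjoint.

(** * Complex measures and positive operator valued measures *)

Section complex_measures.
Context {d : measure_display} {X : measurableType d} {R : realType}.
Implicit Types (m : set X -> R[i]) (A B : set X).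

Lemma limit_unique (u : nat -> R[i]^o) (l l' : R[i]^o) :
  u @ \oo --> l -> u @ \oo --> l' -> l = l'.
Proof.
move=> /cvgrPdist_lt ul /cvgrPdist_lt ul'; apply/eqP.
rewrite -subr_eq0 -normr_eq0; apply/negPn/negP => ll.
have ll0 : 0 < `|l - l'| / 2 by rewrite divr_gt0// lt_neqAle eq_sym ll normr_ge0.
have [N _ NP] := ul _ ll0; have [M _ MP] := ul' _ ll0.
have h1 := NP (maxn N M) (leq_maxl _ _).
have h2 := MP (maxn N M) (leq_maxr _ _).
have : `|l - l'| < `|l - l'|.
  rewrite [ltRHS]splitr; apply: le_lt_trans (ltrD h1 h2).
  apply: le_trans (ler_normB _ _).
  by rewrite (_ : l - _ - _ = l - l')//; ring.
by rewrite ltxx.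
Qed.

Lemma eventually_cst_lim (u : nat -> R[i]^o) (N : nat) (a l : R[i]^o) :
  (forall n, (N <= n)%N -> u n = a) -> u @ \oo --> l -> l = a.
Proof.
move=> ua /cvgrPdist_lt ul; apply/eqP; rewrite -subr_eq0 -normr_eq0.
apply/negPn/negP => la.
have la0 : 0 < `|l - a| by rewrite lt_neqAle eq_sym la normr_ge0.
have [M _ MP] := ul _ la0.
by have := MP (maxn M N) (leq_maxl _ _); rewrite /= ua ?leq_maxr// ltxx.
Qed.

(** The axiom only constrains measurable sets, and the functions built from
the values of an operator measure are only controlled there. *)
Lemma cmeasure_ext m m' :
  (forall A, measurable A -> m A = m' A) ->
  complex_measure m -> complex_measure m'.
Proof.
move=> mm cm A mA tA; rewrite -mm; last exact: bigcup_measurable.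
rewrite (_ : (fun n => _) = (fun n => \sum_(i < n) m (A i) : R[i]^o)).
  exact: cm.
by apply/funext => n; apply: eq_bigr => i _; rewrite mm.
Qed.

(** Additivity along the constant sequence of empty sets makes the multiples of
the value at the empty set converge. *)
Lemma cmeasure0 m : complex_measure m -> m set0 = 0.
Proof.
move=> cm; have := cm (fun=> set0) (fun=> measurable0)
  ltac:(by move=> i j _ _ [x []]).
rewrite bigcup0//; set c := m set0 => /cvgrPdist_lt cvg_c.
apply/eqP; rewrite -normr_eq0; apply/negPn/negP => c0.
have c2 : 0 < `|c| / 2 by rewrite divr_gt0// lt_neqAle eq_sym c0 normr_ge0.
have [N _ NP] := cvg_c _ c2.
have := NP N.+1 (leqnSn N); have := NP N (leqnn N).
rewrite /= big_ord_recr /= -/c; set s : R[i] := \sum_(_ < _) _ => h1 h2.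
have : `|c| < `|c|.
  rewrite [ltRHS]splitr; apply: le_lt_trans (ltrD h1 h2).
  apply: le_trans (ler_normB _ _).
  by rewrite (_ : c - s - _ = c)//; ring.
by rewrite ltxx.
Qed.

Lemma cmeasureU m A B : complex_measure m -> measurable A -> measurable B ->
  A `&` B = set0 -> m (A `|` B) = m A + m B.
Proof.
move=> cm mA mB AB.
have mb n : measurable (bigcup2 A B n).
  by case: n => [|[|n]] //=; exact: measurable0.
have tb : trivIset setT (bigcup2 A B) by rewrite -trivIset_bigcup2.
have := cm _ mb tb; rewrite bigcup2E.
move=> /(eventually_cst_lim (N := 2)); apply => -[|[|n]]// _.
rewrite 2!big_ord_recl big1 ?addr0//= => i _.
exact: cmeasure0.
Qed.

Lemma cmeasure_scale m (a : R[i]) :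
  complex_measure m -> complex_measure (fun A => a * m A).
Proof.
move=> cm A mA tA; rewrite (_ : (fun n => _) =
  (fun n => a *: (\sum_(i < n) m (A i) : R[i]^o))); last first.
  by apply/funext => n; rewrite -mulr_sumr.
by apply: cvgZl_tmp; exact: cm.
Qed.

Lemma cmeasure_add m m' : complex_measure m -> complex_measure m' ->
  complex_measure (fun A => m A + m' A).
Proof.
move=> cm cm' A mA tA; rewrite (_ : (fun n => _) =
  (fun n => (\sum_(i < n) m (A i) : R[i]^o) + (\sum_(i < n) m' (A i) : R[i]^o)));
  last by apply/funext => n; rewrite -big_split.
by apply: cvgD; [exact: cm|exact: cm'].
Qed.

Lemma cmeasure_restr m B : measurable B -> complex_measure m ->
  complex_measure (fun A => m (A `&` B)).
Proof.
move=> mB cm A mA tA; rewrite setI_bigcupl; apply: cm.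
  by move=> n; exact: measurableI.
exact: trivIset_setIr.
Qed.

(** The sets need not be disjoint, whence the condition on all subsets: a
complex measure may vanish on a set without vanishing inside it. *)
Lemma cmeasure_null m (A : (set X)^nat) : complex_measure m ->
  (forall n, measurable (A n)) ->
  (forall n B, measurable B -> B `<=` A n -> m B = 0) -> m (\bigcup_n A n) = 0.
Proof.
move=> cm mA m0; rewrite seqDU_bigcup_eq.
have mD := seqDU_measurable mA.
have := cm (seqDU A) mD (trivIset_seqDU A).
move=> /(eventually_cst_lim (N := 0)); apply => n _.
by rewrite big1// => i _; apply: (m0 i) => //; exact: subset_seqDU.
Qed.

End complex_measures.

Section povm_facts.
Context {d : measure_display} {X : measurableType d} {R : realType}.
Context {H : hilbertType R} {mu : set X -> H -> H}.
Implicit Types (A B : set X) (h k : H).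
Hypothesis mu_povm : povm mu.

Lemma povm_linear A : measurable A -> linear (mu A).
Proof. by move=> /(mu_povm.1 A)[[]]. Qed.

Lemma povm_positive A : measurable A -> positive_op (mu A).
Proof. by move=> /(mu_povm.1 A)[]. Qed.

Lemma povm_selfadj A : measurable A -> selfadj (mu A).
Proof.
move=> mA; apply: positive_selfadj; [exact: povm_linear|exact: povm_positive].
Qed.

Lemma povm0 : mu set0 = (fun=> 0).
Proof.
apply/funext => k; apply: inner_ext => h.
by rewrite inner0r (cmeasure0 (mu_povm.2 h k)).
Qed.

Lemma povmU A B h : measurable A -> measurable B -> A `&` B = set0 ->
  mu (A `|` B) h = mu A h + mu B h.
Proof.
move=> mA mB AB; apply: inner_ext => k.
by rewrite innerDr (cmeasureU (mu_povm.2 k h)).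
Qed.

Lemma povmID A B h : measurable A -> measurable B ->
  mu A h = mu (A `&` B) h + mu (A `\` B) h.
Proof.
move=> mA mB; rewrite -povmU ?setUIDK//; [exact: measurableI|exact: measurableD|].
by rewrite setDE setIACA setICr setI0.
Qed.

Lemma povm_le A B h : measurable A -> measurable B -> A `<=` B ->
  rdot h (mu A h) <= rdot h (mu B h).
Proof.
move=> mA mB /setIidr AB; rewrite (povmID h mB mA) AB rdotDr lerDl.
by apply: rdot_ge0; apply: povm_positive; exact: measurableD.
Qed.

Lemma povm_null_le A B h : measurable A -> measurable B -> A `<=` B ->
  mu B h = 0 -> mu A h = 0.
Proof.
move=> mA mB AB B0; apply: positive_eq0.
- exact: povm_linear.
- exact: povm_positive.
apply/eqP; rewrite eq_le (rdot_ge0 (povm_positive mA)) andbT.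
by apply: le_trans (povm_le _ mA mB AB) _; rewrite B0 rdot0r.
Qed.

Lemma povm_null_bigcup (A : (set X)^nat) h : (forall n, measurable (A n)) ->
  (forall n, mu (A n) h = 0) -> mu (\bigcup_n A n) h = 0.
Proof.
move=> mA A0; apply: inner_ext => k; rewrite inner0r.
apply: (cmeasure_null (mu_povm.2 k h)) => // n B mB BA.
by rewrite (povm_null_le mB (mA n) BA)// inner0r.
Qed.

Hypothesis mu1 : mu setT = id.

Lemma povmC A h : measurable A -> mu (~` A) h = h - mu A h.
Proof.
move=> mA; apply/eqP; rewrite eq_sym subr_eq addrC -povmU//.
- by rewrite setUCr mu1.
- exact: measurableC.
- by rewrite setICr.
Qed.

Lemma povm_le1 A h : measurable A -> rdot h (mu A h) <= nsq h.
Proof.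
by move=> mA; rewrite /nsq -[X in _ <= rdot _ X]/(id h) -mu1; exact: povm_le.
Qed.

(** When [mu A] is idempotent, its range is annihilated by [mu] of the
complement of [A]. *)
Lemma povm_idem_sub A B h : measurable A -> measurable B -> A `<=` B ->
  mu A (mu A h) = mu A h -> mu B (mu A h) = mu A h.
Proof.
move=> mA mB AB idA; suff : mu (~` B) (mu A h) = 0.
  by rewrite povmC// => /eqP; rewrite subr_eq0 eq_sym => /eqP.
apply: (povm_null_le _ (measurableC mA)); first exact: measurableC.
  exact: subsetC.
by rewrite povmC// idA subrr.
Qed.

Lemma povm_idem_disj A B h : measurable A -> measurable B -> A `&` B = set0 ->
  mu A (mu A h) = mu A h -> mu B (mu A h) = 0.
Proof.
move=> mA mB AB idA; apply: (povm_null_le mB (measurableC mA)).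
  by rewrite -disjoints_subset setIC.
by rewrite povmC// idA subrr.
Qed.

Lemma povm_idem_restr A B h : measurable A -> measurable B ->
  mu A (mu A h) = mu A h -> mu B (mu A h) = mu (B `&` A) (mu A h).
Proof.
move=> mA mB idA; rewrite (povmID _ mB mA) (@povm_idem_disj A (B `\` A)) ?addr0//.
  exact: measurableD.
by rewrite setDE setIC -setIA setICl setI0.
Qed.

End povm_facts.

(** * Near eigenvectors of positive contractions *)

Section near_eigenvectors.
Context {R : realType} {H : hilbertType R} (T : H -> H).
Implicit Types h k x : H.
Hypotheses (lT : linear T) (pT : positive_op T).
Hypothesis T_le1 : forall h, rdot h (T h) <= nsq h.

Let sT : selfadj T. Proof. exact: positive_selfadj. Qed.

Lemma contraction_nsq h : nsq (T h) <= rdot h (T h).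
Proof.
rewrite -[leRHS]mul1r; apply: nsq_le_rdot => // x; rewrite mul1r; exact: T_le1.
Qed.

(** The quadratic form of T - T^2, which vanishes exactly when [T] is
idempotent. *)
Definition gap h : R := rdot h (T h) - nsq (T h).

Lemma gapE h : gap h = rdot h (T h - T (T h)).
Proof. by rewrite /gap rdotBr (rdot_selfadj sT h (T h)). Qed.

(** This is t - t^2 <= 1/4 for operators: the difference is the square of
2T - 1. *)
Lemma gap_le h : gap h *+ 4 <= nsq h.
Proof.
rewrite -subr_ge0; have := nsq_ge0 (toC 2 *: T h - h).
by rewrite nsqB nsqZr rdotZl /gap (rdotC h); congr (_ <= _); ring.
Qed.

Lemma gap_op_linear : linear (fun h => T h - T (T h)).
Proof.
move=> a x y; rewrite !(linD lT, linZ lT) scalerBr opprD !addrA.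
by congr (_ - _); rewrite addrAC.
Qed.

Lemma gap_op_selfadj : selfadj (fun h => T h - T (T h)).
Proof. by move=> x y; rewrite innerBl innerBr sT !(sT x) sT. Qed.

Lemma gap_op_positive : positive_op (fun h => T h - T (T h)).
Proof.
apply: selfadj_positive; first exact: gap_op_selfadj.
by move=> h; rewrite -gapE subr_ge0 contraction_nsq.
Qed.

Definition near_eigenvalue (t : R) := forall e : R, 0 < e ->
  exists k, 0 < nsq k /\ nsq (T k - toC t *: k) <= e * nsq k.

(** Let m > 0 be the supremum of the quadratic form of T - T^2 on unit vectors.
It is approached along almost-kernel vectors of N = m - T + T^2 >= 0, and N
factors as (T - a)(T - b), where a and b = 1 - a are the roots of x^2 - x + m;
they lie strictly between 0 and 1 because 0 < m <= 1/4. So either T - b is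
small on these vectors, or T - a is small on their images under T - b. *)
Lemma near_eigenvalue_exists : (exists h, T (T h) <> T h) ->
  exists t, [/\ 0 < t, t < 1 & near_eigenvalue t].
Proof.
move=> [h0 Th0].
have nh0 : 0 < nsq h0.
  by apply: nsq_gt0 => h00; apply: Th0; rewrite h00 !(lin0 lT).
have gh0 : 0 < gap h0.
  rewrite lt_neqAle; apply/andP; split; last first.
    by rewrite gapE; exact: (rdot_ge0 gap_op_positive).
  apply/eqP => /esym; rewrite gapE => gh0; apply: Th0; apply/esym/eqP.
  rewrite -subr_eq0; apply/eqP.
  exact: (positive_eq0 gap_op_linear gap_op_positive).
pose E := [set gap h / nsq h | h in [set h | 0 < nsq h]].
have E_sup : has_sup E.
  split; first by exists (gap h0 / nsq h0), h0.
  exists 1 => _ [h /= nh <-]; rewrite ler_pdivrMr// mul1r.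
  have := gap_le h; lra.
pose m := sup E.
have gap_m h : gap h <= m * nsq h.
  have [/nsq_eq0 ->|/eqP nh] := eqVneq (nsq h) 0.
    by rewrite /gap (lin0 lT) /nsq rdot0r subr0 mulr0.
  have {}nh : 0 < nsq h by rewrite lt_neqAle nsq_ge0 eq_sym andbT; apply/eqP.
  by rewrite -ler_pdivrMr//; apply: ub_le_sup; [case: E_sup|exists h].
have m_gt0 : 0 < m.
  by have := gap_m h0; have := lt_le_trans gh0; move=> /[apply]; rewrite pmulr_lgt0.
have m4 : m *+ 4 <= 1.
  suff : m <= 4^-1 by lra.
  apply: ge_sup; first by case: E_sup.
  move=> _ [h /= nh <-]; rewrite ler_pdivrMr//; have := gap_le h; lra.
pose N h := toC m *: h - (T h - T (T h)).
have lN : linear N.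
  move=> a x y; rewrite /N gap_op_linear; apply: inner_ext => k.
  by rewrite !(innerDr, innerNr, innerZr); ring.
have sN : selfadj N.
  move=> x y; rewrite /N innerBl innerBr innerZl innerZr conj_toC.
  by rewrite gap_op_selfadj.
have rN h : rdot h (N h) = m * nsq h - gap h by rewrite /N rdotBr -gapE rdotZr.
have pN : positive_op N.
  by apply: selfadj_positive => // h; rewrite rN subr_ge0.
have N_le h : nsq (N h) <= m * (m * nsq h - gap h).
  rewrite -rN; apply: nsq_le_rdot => //; first exact: ltW.
  move=> x; rewrite rN gerBl gapE; exact: (rdot_ge0 gap_op_positive).
pose s := Num.sqrt (1 - m *+ 4).
have s2 : s ^+ 2 = 1 - m *+ 4 by rewrite sqr_sqrtr//; lra.
have s0 : 0 <= s by exact: sqrtr_ge0.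
have s1 : s < 1 by nra.
pose a := (1 - s) / 2; pose b := (1 + s) / 2.
have [a0 a1 b0 b1] : [/\ 0 < a, a < 1, 0 < b & b < 1].
  by rewrite /a /b; split; lra.
have ab1 : a + b = 1 by rewrite /a /b; lra.
have abm : a * b = m.
  have -> : m = (1 - s ^+ 2) / 4 by rewrite s2; field.
  by rewrite /a /b; field.
have Nab h : N h = T (T h - toC b *: h) - toC a *: (T h - toC b *: h).
  have bE : toC b = 1 - toC a by rewrite (_ : b = 1 - a) ?rmorphB ?rmorph1//; lra.
  rewrite /N (linB lT) (linZ lT) -abm rmorphM /= bE; apply: inner_ext => k.
  by rewrite !(innerDr, innerNr, innerZr); ring.
have [near_b|/existsNP[e0 /not_implyP[e00 far_b]]] := pselect (near_eigenvalue b).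
  by exists b.
exists a; split=> // e e_gt0.
have eps : 0 < e * e0 / m by rewrite divr_gt0// mulr_gt0.
have [_ [h /= nh <-] hm] := sup_adherent eps E_sup.
have {}hm : m * nsq h - gap h <= e * e0 / m * nsq h.
  have := ltW hm; rewrite -/m ler_pdivlMr//; lra.
pose k := T h - toC b *: h.
have hk : e0 * nsq h < nsq k.
  by rewrite ltNge; apply/negP => hk; apply: far_b; exists h.
exists k; split; first by apply: le_lt_trans hk; rewrite mulr_ge0// ltW.
rewrite -Nab; apply: le_trans (N_le h) _.
apply: le_trans (_ : e * (e0 * nsq h) <= _); last by rewrite ler_pM2l// ltW.
apply: le_trans (ler_wpM2l (ltW m_gt0) hm) _.
by rewrite le_eqVlt; apply/orP; left; apply/eqP; field; exact: lt0r_neq0.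
Qed.

(** For t close to an approximate eigenvalue t0, let [k] be a sufficiently good
approximate eigenvector, h = T k and v = (T - t) h = T w with w = (T - t) k.
The perturbation is a multiple of <v,.>v, with the only coefficient that makes
the eigenvalue equation hold at [h]. It is dominated by T/4 since v lies in the
range of [T], which gives |<v,x>|^2 <= <w, T w> <x, T x>, and since w is close
to (t0 - t) k: the coefficient has order 1/(t0 - t) while <w, T w> has order
(t0 - t)^2. The width (1 - t0) t0^2 / 64 of the admissible interval makes these
orders of magnitude precise. *)
Lemma rank_one_perturbation (t0 t : R) : 0 < t0 -> t0 < 1 ->
  near_eigenvalue t0 -> t0 - (1 - t0) * t0 ^+ 2 / 64 < t -> t < t0 ->
  exists (e h : H) (c : R), [/\ nsq e = 1, h <> 0,
    `|c| <= 4^-1, forall x, `|c| * modsq (inner e x) <= rdot x (T x) / 4 &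
    T h + toC (c * (1 - t) *+ 2) *: (inner e h *: e) = toC t *: h].
Proof.
move=> t0_gt0 t0_lt1 t0_near lo hi; pose dl := t0 - t.
have dl_gt0 : 0 < dl by rewrite /dl; lra.
have t02 : 0 < t0 ^+ 2 by rewrite exprn_gt0.
have t021 : t0 ^+ 2 < 1 by nra.
have dl_small : dl * 64 < (1 - t0) * t0 ^+ 2 by rewrite /dl; lra.
have dl_lt1 : dl < 1 by nra.
have [|k [k_gt0 k_near]] := t0_near (dl ^+ 2 * t0 ^+ 2 / 16).
  by rewrite !divr_gt0// mulr_gt0// exprn_gt0.
set et := T k - toC t0 *: k in k_near; set n := nsq k in k_gt0 k_near.
pose w := T k - toC t *: k; pose v := T w; pose h := T k.
have wE : w = et + toC dl *: k.
  rewrite /w /et /dl rmorphB /=; apply: inner_ext => x.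
  by rewrite !(innerDr, innerNr, innerZr); ring.
have hE : h = et + toC t0 *: k by rewrite /et subrK.
clearbody et.
pose b := rdot v h.
have ww : rdot w v <= (nsq et + dl ^+ 2 * n) *+ 2.
  apply: le_trans (T_le1 w) _; rewrite -subr_ge0.
  have := nsq_ge0 (et - toC dl *: k); rewrite wE nsqB nsqD rdotZr nsqZr -/n.
  by congr (_ <= _); ring.
have hh : t0 ^+ 2 * n / 2 - nsq et <= nsq h.
  have := nsq_ge0 (toC 2 *: et + toC t0 *: k).
  rewrite hE !nsqD !nsqZr !rdotZr !rdotZl -/n; lra.
have Tet : nsq (T et) <= nsq et by apply: le_trans (contraction_nsq et) (T_le1 et).
have bb : dl * b >= dl ^+ 2 * nsq h * (3 / 4) - nsq et.
  have := nsq_ge0 (T et + toC (dl / 2) *: h).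
  rewrite nsqD nsqZr rdotZr /b /v wE (linD lT) (linZ lT) !rdotE -/h -/(nsq h).
  lra.
(* the inner product of v and h is about dl times the square norm of T k *)
have b_big : dl * t0 ^+ 2 * n / 4 <= b.
  rewrite -(ler_pM2l dl_gt0); apply: le_trans bb.
  have d2 : 0 < dl ^+ 2 by rewrite exprn_gt0.
  have d21 : dl ^+ 2 < 1 by nra.
  have := ler_wpM2l (ltW d2) hh.
  have := ler_piMl (nsq_ge0 et) (ltW d21); have := k_near.
  have := mulr_gt0 (mulr_gt0 d2 t02) k_gt0; lra.
have b_gt0 : 0 < b.
  by apply: lt_le_trans b_big; rewrite !divr_gt0// !mulr_gt0.
have v_neq0 : v <> 0 by move=> v0; move: b_gt0; rewrite /b v0 rdotC rdot0r ltxx.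
have nv := nsq_gt0 v_neq0.
have key : rdot w v *+ 2 <= (1 - t) * b.
  have := ler_wpM2l (ltW k_gt0) (ltW t021).
  have := ler_wpM2l (ltW (mulr_gt0 dl_gt0 k_gt0)) (ltW dl_small).
  have t1 : 1 - t0 <= 1 - t by lra.
  have t10 : 0 < 1 - t0 by lra.
  have := ler_wpM2r (ltW b_gt0) t1; have := ler_wpM2l (ltW t10) b_big.
  have : dl ^+ 2 * (t0 ^+ 2 * n) <= dl ^+ 2 * n.
    by rewrite ler_wpM2l ?sqr_ge0// ler_piMl ?(ltW k_gt0) ?(ltW t021).
  by move: ww k_near; have := mulr_gt0 (exprn_gt0 2 dl_gt0) k_gt0; lra.
pose c := - (nsq v / ((1 - t) * b *+ 2)).
have tb : 0 < (1 - t) * b *+ 2 by rewrite pmulrn_lgt0// mulr_gt0//; lra.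
have cE : `|c| = nsq v / ((1 - t) * b *+ 2).
  by rewrite /c normrN ger0_norm// divr_ge0// ltW.
pose r := Num.sqrt (nsq v)^-1.
have r2 : r ^+ 2 = (nsq v)^-1 by rewrite sqr_sqrtr// invr_ge0 ltW.
pose e := toC r *: v.
have ne : nsq e = 1 by rewrite /e nsqZr r2 mulVf// lt0r_neq0.
have ce x : `|c| * modsq (inner e x) <= rdot x (T x) / 4.
  have -> : modsq (inner e x) = modsq (inner w (T x)) / nsq v.
    rewrite /e innerZl conj_toC /v -(sT w x) -r2 /modsq.
    by case: (inner w (T x)) => ? ? /=; ring.
  have := inner_CS lT pT w x; rewrite -/v; set q := modsq _; set p := rdot x _.
  have p0 : 0 <= p by exact: rdot_ge0.
  rewrite cE => qp.
  rewrite [leLHS](_ : _ = q / ((1 - t) * b *+ 2)); last first.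
    by move: tb nv; move: (_ *+ 2) (nsq v) => z y z0 y0; field; rewrite !lt0r_neq0.
  rewrite ler_pdivrMr//; apply: le_trans qp _.
  have := ler_wpM2r p0 key; lra.
exists e, h, c; split=> //.
- by move=> h0; move: b_gt0; rewrite /b h0 rdot0r ltxx.
- have := ce e; rewrite inner_nsq ne /modsq /= expr0n addr0 expr1n mulr1 => ce1.
  by apply: le_trans ce1 _; have := T_le1 e; rewrite ne; lra.
have vh : inner v h = toC b.
  rewrite /b /rdot.
  have -> : inner v h = toC (rdot h (T h) - t * nsq h).
    rewrite /v -sT /w innerBl -/h innerZl conj_toC (sT k) -/h.
    by rewrite (selfadj_inner sT) inner_nsq rmorphB rmorphM.
  by [].
rewrite /e innerZl conj_toC vh scalerA scalerA -!rmorphM /=.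
rewrite (_ : _ * _ * _ = - 1); last first.
  rewrite (_ : _ * _ = c * ((1 - t) * b *+ 2) * r ^+ 2); last by ring.
  rewrite r2 /c; move: tb nv; move: (_ *+ 2) (nsq v) => z y z0 y0.
  by field; rewrite !lt0r_neq0.
rewrite rmorphN rmorph1 scaleN1r /v /w (linB lT) (linZ lT) -/h.
by rewrite opprB addrC subrK.
Qed.

End near_eigenvectors.

(** * Scalars plus rank one, and separability *)

Section bounded_ops.
Context {R : realType} {H : hilbertType R}.
Implicit Types (T S : H -> H) (h k x : H).

Lemma bounded_comp T S : bounded_op T -> bounded_op S -> bounded_op (T \o S).
Proof.
move=> /bounded_opP[lT [c [c0 Tc]]] /bounded_opP[lS [b [b0 Sb]]].
apply/bounded_opP; split=> [a x y|]; first by rewrite /= lS lT.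
exists (c * b); split=> [|h]; first exact: mulr_ge0.
by apply: le_trans (Tc _) _; rewrite -mulrA ler_wpM2l.
Qed.

Lemma nsqD_le x y : nsq (x + y) <= (nsq x + nsq y) *+ 2.
Proof.
by rewrite -subr_ge0; have := nsq_ge0 (x - y); rewrite nsqB nsqD;
  congr (_ <= _); ring.
Qed.

Lemma bounded_add T S : bounded_op T -> bounded_op S ->
  bounded_op (fun h => T h + S h).
Proof.
move=> /bounded_opP[lT [c [c0 Tc]]] /bounded_opP[lS [b [b0 Sb]]].
apply/bounded_opP; split=> [a x y|].
  by rewrite lT lS scalerDr !addrA; congr (_ + _); rewrite addrAC.
exists ((c + b) *+ 2); split=> [|h]; first by rewrite mulrn_wge0// addr_ge0.
apply: le_trans (nsqD_le _ _) _; rewrite mulrnAl ler_wMn2r// mulrDl.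
exact: lerD.
Qed.

Lemma bounded_id : bounded_op (@id H).
Proof.
by apply/bounded_opP; split=> //; exists 1; split=> // h; rewrite mul1r.
Qed.

Lemma bounded_scale (a : R[i]) T : bounded_op T -> bounded_op (fun h => a *: T h).
Proof.
move=> /bounded_opP[lT [c [c0 Tc]]]; apply/bounded_opP; split=> [b x y|].
  by rewrite lT scalerDr !scalerA mulrC.
have an : `|a| ^+ 2 = toC (Re (`|a| ^+ 2)) by rewrite -toC_Re// exprn_ge0.
exists (Re (`|a| ^+ 2) * c); split=> [|h].
  by rewrite mulr_ge0// -ler0c -an exprn_ge0.
rewrite -lecR nsqZ an -rmorphM lecR -mulrA ler_wpM2l//.
by rewrite -ler0c -an exprn_ge0.
Qed.

Lemma modsq_le e h : modsq (inner e h) <= nsq e * nsq h.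
Proof. by apply: (@inner_CS _ _ id) => // x; rewrite inner_nsq ler0c nsq_ge0. Qed.

Lemma bounded_rank_one e : bounded_op (fun h => inner e h *: e).
Proof.
apply/bounded_opP; split=> [a x y|].
  by rewrite innerDr innerZr scalerDl scalerA.
exists (nsq e ^+ 2); split=> [|h]; first exact: sqr_ge0.
rewrite -lecR nsqZ -add_Re2_Im2 -rmorphM lecR -/(modsq _).
by rewrite expr2 -mulrA mulrC ler_wpM2l ?nsq_ge0// modsq_le.
Qed.

Lemma bounded_linear T : bounded_op T -> linear T. Proof. by case. Qed.

Lemma selfadj_adj T : bounded_op T -> selfadj T -> adj T = T.
Proof. by move=> bT sT; apply: adj_unique. Qed.

(** For a unit vector [e], the operator acting as the scalar [a] on [e] and as
the scalar [b] on its orthocomplement. Square roots and inverses of these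
operators are computed on the two scalars. *)
Definition two_scalars e (a b : R) h : H :=
  toC b *: h + toC (a - b) *: (inner e h *: e).

Lemma two_scalars_bounded e a b : bounded_op (two_scalars e a b).
Proof.
apply: bounded_add; first exact: (bounded_scale _ bounded_id).
apply: bounded_scale; exact: bounded_rank_one.
Qed.

Lemma two_scalars_selfadj e a b : selfadj (two_scalars e a b).
Proof.
move=> x y; rewrite /two_scalars !(innerDl, innerDr, innerZl, innerZr) !conj_toC.
by rewrite inner_conj; ring.
Qed.

Lemma two_scalars_comp e a b a' b' h : nsq e = 1 ->
  two_scalars e a b (two_scalars e a' b' h) = two_scalars e (a * a') (b * b') h.
Proof.
move=> e1; apply: inner_ext => x; rewrite /two_scalars.
rewrite !(innerDr, innerZr) inner_nsq e1 !rmorphB !rmorphM rmorph1 /=; ring.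
Qed.

Lemma two_scalars1 e h : two_scalars e 1 1 h = h.
Proof. by rewrite /two_scalars subrr !scale0r addr0 scale1r. Qed.

End bounded_ops.

Section separability.
Context {R : realType} {H : hilbertType R}.
Hypothesis sepH : separable_space H.

(** Points of a countable dense set that are close enough to orthogonal vectors
are distinct. *)
Lemma countable_orthogonal (I : Type) (A : set I) (e : I -> H) :
  (forall i, A i -> e i <> 0) ->
  (forall i j, A i -> A j -> i <> j -> rdot (e i) (e j) = 0) -> countable A.
Proof.
have [D cD dD] := sepH; move=> e0 orth.
have [f fP] : exists f : I -> H, forall i, A i -> 
    D (f i) /\ nsq (f i - e i) *+ 4 < nsq (e i).
  suff /choice[f fP] : forall i, exists x, A i ->
      D x /\ nsq (x - e i) *+ 4 < nsq (e i) by exists f.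
  move=> i; have [Ai|nAi] := pselect (A i); last by exists 0.
  have ni := nsq_gt0 (e0 _ Ai).
  pose r := Num.sqrt (nsq (e i) / 4).
  have r0 : 0 < r by rewrite sqrtr_gt0 divr_gt0.
  have r2 : r ^+ 2 = nsq (e i) / 4 by rewrite sqr_sqrtr// divr_ge0// ltW.
  have [||x [xb Dx]] := dD (ball (e i) (toC r)).
  - exists (e i); apply: ballxx; by rewrite ltcR.
  - apply: ball_open; by rewrite ltcR.
  exists x => _; split=> //.
  move: xb; rewrite -ball_normE /ball_ /= distrC norm_lt_nsq// r2; lra.
have /countable_injP[g g_inj] := cD; apply/countable_injP; exists (g \o f).
move=> i j /set_mem Ai /set_mem Aj /= gf; apply: contrapT => ij.
have [[Di di] [Dj dj]] := (fP _ Ai, fP _ Aj).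
have fij : f i = f j by apply: g_inj => //; exact: mem_set.
have := nsqD_le (f j - e j) (- (f i - e i)).
rewrite (_ : f j - e j - _ = e i - e j); last first.
  by rewrite fij; apply: inner_ext => x; rewrite !(innerDr, innerNr); ring.
rewrite nsqN nsqB (orth _ _ Ai Aj ij).
have := nsq_gt0 (e0 _ Ai); have := nsq_gt0 (e0 _ Aj).
by clear -di dj; lra.
Qed.

Lemma countable_eigenvalues (T : H -> H) : selfadj T ->
  countable [set t : R | exists h, h <> 0 /\ T h = toC t *: h].
Proof.
move=> sT; set E := [set t | _].
have [e eP] : exists e : R -> H, forall t, E t -> e t <> 0 /\ T (e t) = toC t *: e t.
  suff /choice[e eP] : forall t, exists h, E t -> h <> 0 /\ T h = toC t *: h.
    by exists e.
  by move=> t; have [[h hP]|nE] := pselect (E t); [exists h|exists 0].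
apply: (@countable_orthogonal _ _ e) => [t /eP[]//|s t Es Et st].
have [_ es] := eP _ Es; have [_ et] := eP _ Et.
have := rdot_selfadj sT (e s) (e t); rewrite es et rdotZr rdotZl => /eqP.
rewrite -subr_eq0 -mulrBl mulf_eq0 subr_eq0 => /orP[/eqP ts|/eqP//].
by case: st.
Qed.

Lemma interval_uncountable (a b : R) : a < b -> ~ countable `]a, b[%classic.
Proof.
move=> ab /countable_lebesgue_measure0.
rewrite lebesgue_measure_itv /= lte_fin ab => /eqP.
by rewrite -EFinD eqe subr_eq0 gt_eqF.
Qed.

End separability.

(** * Atoms of a C*-extreme measure are projections *)

Section extremal_perturbation.
Context {d : measure_display} {X : measurableType d} {R : realType}.
Context {H : hilbertType R} {mu : set X -> H -> H}.
Hypothesis mu_ext : Cstar_extreme mu.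

Let mu_povm : povm mu. Proof. exact: mu_ext.1.1. Qed.
Let mu1 : mu setT = id. Proof. exact: mu_ext.1.2. Qed.

(** The two summands mu/2 + dl c<e,.>e and mu/2 - dl c<e,.>e of [mu] have total
masses 1/2 + c<e,.>e and 1/2 - c<e,.>e, whose square roots [T i] are explicit.
Normalising by them writes [mu] as a C*-convex combination; the conclusion says
that the first summand is [mu] transported by [U], before normalisation. *)
Lemma extreme_rank_one (e : H) (c : R) (dl : set X -> R) :
  nsq e = 1 -> `|c| <= 4^-1 -> dl setT = 1 ->
  complex_measure (fun A => toC (dl A)) ->
  (forall A, measurable A -> 0 <= dl A) ->
  (forall A x, measurable A ->
     dl A * (`|c| * modsq (inner e x)) <= rdot x (mu A x) / 2) ->
  exists (r y : R) (U : H -> H), [/\ r != 0, y != 0, unitary U &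
    forall A h, measurable A ->
      two_scalars e r y (adj U (mu A (U (two_scalars e r y h)))) =
      toC 2^-1 *: mu A h + toC (c * dl A) *: (inner e h *: e)].
Proof.
move=> e1 c4 dlT dl_cm dl_ge0 dl_le.
(* the signs of the perturbation in the two summands *)
pose sg (i : 'I_2) : R := if i == ord0 then 1 else - 1.
have sg_norm i : `|sg i| = 1 by rewrite /sg; case: ifP; rewrite ?normrN normr1.
pose y : R := Num.sqrt 2^-1.
have y2 : y ^+ 2 = 2^-1 by rewrite sqr_sqrtr// invr_ge0.
have y0 : y != 0 by rewrite gt_eqF// sqrtr_gt0 invr_gt0.
pose r i := Num.sqrt (2^-1 + sg i * c).
have r_gt0 i : 0 < 2^-1 + sg i * c.
  have : `|sg i * c| <= 4^-1 by rewrite normrM sg_norm mul1r.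
  by rewrite ler_norml => /andP[]; lra.
have r2 i : r i ^+ 2 = 2^-1 + sg i * c by rewrite sqr_sqrtr// ltW.
have r0 i : r i != 0 by rewrite gt_eqF// sqrtr_gt0.
pose T i := two_scalars e (r i) y.
pose V i := two_scalars e (r i)^-1 y^-1.
have VT i h : V i (T i h) = h.
  by rewrite /V /T two_scalars_comp// !mulVf// two_scalars1.
have TV i h : T i (V i h) = h.
  by rewrite /V /T two_scalars_comp// !mulfV// two_scalars1.
have bT i : bounded_op (T i) by exact: two_scalars_bounded.
have bV i : bounded_op (V i) by exact: two_scalars_bounded.
have sT i : selfadj (T i) by exact: two_scalars_selfadj.
have sV i : selfadj (V i) by exact: two_scalars_selfadj.
pose S i A h := toC 2^-1 *: mu A h + toC (sg i * c * dl A) *: (inner e h *: e).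
pose nu i A h := V i (S i A (V i h)).
have nu_norm i : normalized_povm (nu i).
  split; first split.
  - move=> A mA; have bS : bounded_op (S i A).
      apply: bounded_add; apply: bounded_scale; last exact: bounded_rank_one.
      exact: (mu_povm.1 A mA).1.
    split; first exact: (bounded_comp (bV i) (bounded_comp bS (bV i))).
    have sS : selfadj (S i A).
      move=> h k; rewrite /S !(innerDl, innerDr, innerZl, innerZr) !conj_toC.
      by rewrite (povm_selfadj mu_povm mA) inner_conj; ring.
    apply: selfadj_positive => [h k|h]; first by rewrite /nu sV sS sV.
    rewrite /nu (rdot_selfadj (sV i)); set x := V i h.
    rewrite /S rdotDr !rdotZr.
    have -> : rdot x (inner e x *: e) = modsq (inner e x).
      rewrite /rdot innerZr -(inner_conj e x) /modsq.
      by case: (inner e x) => a b /=; ring.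
    have := dl_le A x mA; have := dl_ge0 A mA.
    have : 0 <= modsq (inner e x) by rewrite addr_ge0// sqr_ge0.
    move: (modsq _) (dl A) (rdot _ _) => q D p q0 D0.
    have := ler_norm (- (sg i * c)); rewrite normrN normrM sg_norm mul1r => cle.
    have := ler_wpM2r (mulr_ge0 D0 q0) cle; lra.
  - move=> h k; rewrite (_ : (fun A => _) = (fun A =>
      toC 2^-1 * inner (V i h) (mu A (V i k)) +
      toC (sg i * c) * (inner e (V i k) * inner (V i h) e) * toC (dl A))).
      have cm1 := cmeasure_scale (a := toC 2^-1) (mu_povm.2 (V i h) (V i k)).
      have cm2 := cmeasure_scale
        (a := toC (sg i * c) * (inner e (V i k) * inner (V i h) e)) dl_cm.
      exact: (cmeasure_add cm1 cm2).
    apply/funext => A; rewrite /nu sV /S !(innerDr, innerZr) !rmorphM /=; ring.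
  - apply/funext => h; rewrite /nu; set x := V i h.
    rewrite (_ : S i setT x = T i (T i x)).
      by rewrite VT /x TV.
    rewrite /T two_scalars_comp// -!expr2 r2 y2 /S mu1 dlT mulr1.
    by rewrite /two_scalars (_ : _ - _ = sg i * c)//; ring.
have invT i : invertible (T i).
  split=> //; exists (V i); split=> //; apply/funext => h; [exact: VT|exact: TV].
have adjT i : adj (T i) = T i by exact: selfadj_adj.
have TnuT i A h : adj (T i) (nu i A (T i h)) = S i A h.
  by rewrite adjT /nu VT TV.
have sumS A h : \sum_(i < 2) S i A h = mu A h.
  rewrite big_ord_recl big_ord1 /S /sg /=; apply: inner_ext => x.
  rewrite !(innerDr, innerZr) !rmorphM rmorphN rmorph1 !rmorphV/= ?unitfE//.
  by rewrite rmorph_nat; field.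
have [||||U UP] := mu_ext.2 2 nu T => //.
- move=> h; rewrite -[RHS]/(id h) -mu1 -sumS; apply: eq_bigr => i _.
  have /(congr1 (fun f => f (T i h))) := (nu_norm i).2.
  by rewrite -(TnuT i setT) => ->.
- by move=> A mA h; rewrite -[LHS]sumS; apply: eq_bigr => i _; rewrite TnuT.
have [uU nuU] := UP ord0.
exists (r ord0), y, (U ord0); split=> // A h mA.
have /(congr1 (fun f => f (T ord0 h))) := nuU A mA; rewrite /= => <-.
by rewrite -/(T _ _) /nu VT TV /S /sg eqxx mul1r.
Qed.

Lemma unitaryK (U : H -> H) : unitary U -> cancel U (adj U) /\ cancel (adj U) U.
Proof.
move=> [_ UU VV]; split=> h.
  by rewrite -[RHS]/(id h) -UU.
by rewrite -[RHS]/(id h) -VV.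
Qed.

Hypothesis sepH : separable_space H.

(** Otherwise all t in an interval would be eigenvalues of [mu A]: evaluating
the conclusion of [extreme_rank_one] at [A] and at the whole space, the vector
[h] of [rank_one_perturbation] is sent to an eigenvector. *)
Lemma extreme_atom_idem A : atom mu A -> forall h, mu A (mu A h) = mu A h.
Proof.
move=> [mA A0 A01]; set T := mu A.
have lT : linear T := povm_linear mu_povm mA.
have pT : positive_op T := povm_positive mu_povm mA.
have T_le1 h : rdot h (T h) <= nsq h by exact: povm_le1.
have [h1 h1T] : exists h1, rdot h1 (T h1) <> 0.
  apply/not_existsP => T0; apply: A0; apply/funext => h.
  by apply: positive_eq0 => //; apply: contrapT; exact: T0.
apply: contrapT => /existsNP T_idem.
have [t0 [t0_gt0 t0_lt1 t0_near]] := near_eigenvalue_exists lT pT T_le1 T_idem.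
pose rho := (1 - t0) * t0 ^+ 2 / 64.
have rho_gt0 : 0 < rho by rewrite divr_gt0// mulr_gt0 ?exprn_gt0// subr_gt0.
apply: (@interval_uncountable R (t0 - rho) t0); first by rewrite ltrBlDr ltrDl.
have := countable_eigenvalues sepH (povm_selfadj mu_povm mA).
apply: sub_countable; apply: subset_card_le => t /=.
rewrite in_itv /= => /andP[lo hi].
have [e [h [c [e1 h0 c4 ce Th]]]] :=
  rank_one_perturbation lT pT T_le1 t0_gt0 t0_lt1 t0_near lo hi.
(* the 0-1 measure on the subsets of the atom, read off at a vector h1 *)
pose dl B := Re (inner h1 (mu (B `&` A) h1)) / rdot h1 (T h1).
have dl01 B : measurable B ->
    (dl B = 0) \/ (dl B = 1 /\ mu (B `&` A) = T).
  move=> mB; have [||BA|BA] := A01 (B `&` A).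
  - exact: measurableI.
  - exact: subIsetr.
  - by left; rewrite /dl BA inner0r mul0r.
  - by right; rewrite /dl BA -/(rdot _ _) divff//; apply/eqP.
have [||||||r [y [U [r0 y0 uU UP]]]] := @extreme_rank_one e c dl => //.
- by rewrite /dl setTI divff//; apply/eqP.
- apply: (cmeasure_ext (m := fun B => toC (rdot h1 (T h1))^-1 *
      inner h1 (mu (B `&` A) h1))).
    move=> B mB; rewrite /dl rmorphM /= mulrC; congr (_ * _).
    by rewrite (selfadj_inner (povm_selfadj mu_povm (measurableI _ _ mB mA))).
  apply: cmeasure_scale.
  exact: (cmeasure_restr (m := fun B => inner h1 (mu B h1)) mA (mu_povm.2 _ _)).
- by move=> B /dl01[->|[-> _]].
- move=> B x mB; have x_ge0 := rdot_ge0 (povm_positive mu_povm mB) x.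
  have [->|[-> BA]] := dl01 B mB; first by rewrite mul0r divr_ge0.
  rewrite mul1r; apply: le_trans (ce x) _.
  have : rdot x (T x) <= rdot x (mu B x).
    by rewrite -BA; apply: (povm_le mu_povm) => //; exact: measurableI.
  lra.
have [UK KU] := unitaryK uU.
pose W := two_scalars e r y.
pose g := U (W h).
have W_inj : injective W.
  apply: (can_inj (g := two_scalars e r^-1 y^-1)) => z.
  by rewrite /W two_scalars_comp// !mulVf// two_scalars1.
have W_lin : linear W by apply: bounded_linear; exact: two_scalars_bounded.
have [bU _ _] := uU; have [[aU_lin _] _] := adjP bU.
have U_lin := bounded_linear bU.
exists g; split.
  move=> g0; apply: h0; apply: W_inj; rewrite (lin0 W_lin) -(UK (W h)) -/g g0.
  exact: lin0.
have dlA : dl A = 1 by rewrite /dl setIid divff//; apply/eqP.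
have dlT : dl setT = 1 by rewrite /dl setTI divff//; apply/eqP.
apply: (can_inj KU); apply: W_inj.
have := UP setT h measurableT; rewrite mu1 dlT mulr1 -/W -/g => WT.
have := UP A h mA; rewrite dlA mulr1 -/W -/g -/T => WA.
rewrite (linZ aU_lin) (linZ W_lin) WT WA.
set p := inner e h *: e in Th *.
have -> : T h = toC t *: h - toC (c * (1 - t) *+ 2) *: p by rewrite -Th addrK.
have -> : toC (c * (1 - t) *+ 2) = toC c * (1 - toC t) *+ 2.
  by rewrite rmorphMn rmorphM rmorphB rmorph1.
have -> : toC 2^-1 = 2^-1 :> R[i] by rewrite fmorphV rmorph_nat.
apply: inner_ext => x; rewrite !(innerDr, innerNr, innerZr).
move: (inner x h) (inner x p) (toC c) (toC t) => a b c' t'.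
by field.
Qed.

End extremal_perturbation.

(** * Projections in the range, and block operators *)

Section projections_in_povm.
Context {d : measure_display} {X : measurableType d} {R : realType}.
Context {H : hilbertType R} {mu : set X -> H -> H}.
Hypotheses (mu_povm : povm mu) (mu1 : mu setT = id).
Variable Y : set X.
Hypotheses (mY : measurable Y) (idY : forall h, mu Y (mu Y h) = mu Y h).

(** Subsets of [Y] are null on the kernel of [mu Y], and sets disjoint from [Y]
are null on its range. *)
Lemma povm_capE A h : measurable A -> mu (A `&` Y) h = mu A (mu Y h).
Proof.
move=> mA; rewrite [RHS](povm_idem_restr mu_povm mu1)//.
have lAY := povm_linear mu_povm (measurableI _ _ mA mY).
apply/eqP; rewrite -subr_eq0 -(linB lAY); apply/eqP.
apply: (povm_null_le mu_povm (measurableI _ _ mA mY) mY) => //.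
by rewrite (linB (povm_linear mu_povm mY)) idY subrr.
Qed.

Lemma povm_comm A h : measurable A -> mu Y (mu A h) = mu A (mu Y h).
Proof.
move=> mA; apply: inner_ext => k; rewrite (povm_selfadj mu_povm mY).
rewrite (povm_selfadj mu_povm mA) -!povm_capE//.
by rewrite (povm_selfadj mu_povm (measurableI _ _ mA mY)).
Qed.

End projections_in_povm.

Section range_space.
Context {R : realType} {H : hilbertType R} (P : H -> H).
Hypotheses (bP : bounded_op P) (sP : selfadj P) (PP : forall h, P (P h) = P h).

Let lP : linear P. Proof. exact: bounded_linear. Qed.

Lemma proj_pythagoras h : nsq h = nsq (P h) + nsq (h - P h).
Proof.
have {1}-> : h = P h + (h - P h) by rewrite addrC subrK.
rewrite nsqD -(rdot_selfadj sP) (linB lP) PP subrr.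
by rewrite rdot0r mul0rn addr0.
Qed.

Lemma range_submod_closed : submod_closed (mem [set h | P h = h]).
Proof.
split; first by rewrite inE /= (lin0 lP).
by move=> a x y; rewrite !inE /= => Px Py; rewrite lP Px Py.
Qed.

Lemma range_closed : closed [set h | P h = h].
Proof.
move=> x clx /=; apply/eqP; rewrite -subr_eq0; apply/eqP/nsq_eq0.
apply/eqP; rewrite eq_le nsq_ge0 andbT; apply/ler_addgt0Pr => e; rewrite add0r.
move=> e0; have s0 : 0 < Num.sqrt e by rewrite sqrtr_gt0.
have [|y [/= Py]] := clx (ball x (toC (Num.sqrt e))).
  by apply: nbhsx_ballx; rewrite ltcR.
rewrite -ball_normE /ball_ /= norm_lt_nsq// sqr_sqrtr ?(ltW e0)// => xy.
apply: le_trans (ltW xy); rewrite (proj_pythagoras (x - y)) (linB lP) Py.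
rewrite (_ : x - y - (P x - y) = - (P x - x)) ?nsqN ?lerDr ?nsq_ge0//.
by apply: inner_ext => k; rewrite !(innerDr, innerNr); ring.
Qed.

Definition range_space : closed_subspace H :=
  ClosedSubspace range_submod_closed range_closed.

Lemma in_range_space h : in_csub range_space (P h).
Proof. by rewrite /in_csub inE /= PP. Qed.

Definition to_range h : csub range_space := Csub (in_range_space h).

Lemma range_incl (x : csub range_space) : P (incl x) = incl x.
Proof. by have := incl_in x; rewrite /in_csub inE. Qed.

End range_space.

(** A closed subspace [S] is accessed here through a map [q] onto it whose
composite with the inclusion is a projection [P] of the whole space. *)
Section block_operators.
Context {R : realType} {H : hilbertType R} (P : H -> H).
Context (S : closed_subspace H) (q : H -> csub S).
Hypotheses (bP : bounded_op P) (sP : selfadj P) (PP : forall h, P (P h) = P h).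
Hypotheses (qE : forall h, incl (q h) = P h).
Hypothesis (PS : forall x : csub S, P (incl x) = incl x).

Let lP : linear P. Proof. exact: bounded_linear. Qed.

Lemma incl_inj : injective (@incl R H S). Proof. exact: val_inj. Qed.

Lemma incl_lin a (x y : csub S) : incl (a *: x + y) = a *: incl x + incl y.
Proof. by []. Qed.

Lemma incl0 : incl (0 : csub S) = 0. Proof. by []. Qed.

Lemma incl_inner (x y : csub S) : inner x y = inner (incl x) (incl y).
Proof. by []. Qed.

Lemma incl_nsq (x : csub S) : nsq x = nsq (incl x).
Proof. by []. Qed.

Lemma qK x : q (incl x) = x.
Proof. by apply: incl_inj; rewrite qE PS. Qed.

Lemma q_lin : linear q.
Proof. by move=> a x y; apply: incl_inj; rewrite incl_lin !qE lP. Qed.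

Lemma inner_q h x : inner h (incl x) = inner (q h) x.
Proof. by rewrite incl_inner qE -sP PS. Qed.

Lemma nsq_q h : nsq (q h) <= nsq h.
Proof. by rewrite incl_nsq qE (proj_pythagoras bP sP PP h) lerDl nsq_ge0. Qed.

Definition compress (T : H -> H) (x : csub S) : csub S := q (T (incl x)).

Lemma inner_compress T x y : inner x (compress T y) = inner (incl x) (T (incl y)).
Proof. by rewrite incl_inner qE sP PS. Qed.

Lemma compress_bounded T : bounded_op T -> bounded_op (compress T).
Proof.
move=> /bounded_opP[lT [c [c0 Tc]]]; apply/bounded_opP; split=> [a x y|].
  by rewrite /compress incl_lin lT q_lin.
exists c; split=> // x; apply: le_trans (nsq_q _) _; exact: Tc.
Qed.

Lemma compress_adj T : bounded_op T -> adj (compress T) = compress (adj T).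
Proof.
move=> bT; apply: adj_unique; first exact: compress_bounded.
move=> x y; rewrite inner_compress (adjP bT).2 -[RHS]inner_conj inner_compress.
by rewrite inner_conj.
Qed.

(** The direct sum of [V] on the range of [P] with the restriction of [W] to
the kernel of [P], meaningful when [W] commutes with [P]. *)
Definition block (V : csub S -> csub S) (W : H -> H) h : H :=
  incl (V (q h)) + W (h - P h).

Section one_block.
Variables (V : csub S -> csub S) (W : H -> H).
Hypotheses (bV : bounded_op V) (bW : bounded_op W).
Hypothesis WP : forall h, P (W h) = W (P h).

Let W_cokernel h : P (W (h - P h)) = 0.
Proof. by rewrite WP (linB lP) PP subrr (lin0 (bounded_linear bW)). Qed.

Lemma P_block h : P (block V W h) = incl (V (q h)).
Proof. by rewrite /block (linD lP) PS W_cokernel addr0. Qed.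

Lemma q_block h : q (block V W h) = V (q h).
Proof. by apply: incl_inj; rewrite qE P_block. Qed.

Lemma block_sub h : block V W h - P (block V W h) = W (h - P h).
Proof. by rewrite P_block /block addrAC subrr add0r. Qed.

Lemma block_incl x : block V W (incl x) = incl (V x).
Proof. by rewrite /block qK PS subrr (lin0 (bounded_linear bW)) addr0. Qed.

Lemma inner_block h k :
  inner h (block V W k) = inner (q h) (V (q k)) + inner (h - P h) (W (k - P k)).
Proof.
by rewrite /block innerDr inner_q innerBl -sP W_cokernel inner0r subr0.
Qed.

Lemma block_bounded : bounded_op (block V W).
Proof.
have /bounded_opP[lV [c [c0 Vc]]] := bV.
have /bounded_opP[lW [b [b0 Wb]]] := bW.
apply/bounded_opP; split=> [a x y|].
  rewrite /block q_lin lV incl_lin lP.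
  have -> : a *: x + y - (a *: P x + P y) = a *: (x - P x) + (y - P y).
    by apply: inner_ext => k; rewrite !(innerDr, innerNr, innerZr); ring.
  by rewrite lW scalerDr !addrA; congr (_ + _); rewrite addrAC.
exists ((c + b) *+ 2); split=> [|h]; first by rewrite mulrn_wge0// addr_ge0.
apply: le_trans (nsqD_le _ _) _; rewrite mulrnAl ler_wMn2r// mulrDl lerD//.
  by rewrite -incl_nsq; apply: le_trans (Vc _) _; rewrite ler_wpM2l// nsq_q.
apply: le_trans (Wb _) _; rewrite ler_wpM2l//.
by rewrite (proj_pythagoras bP sP PP h) lerDr nsq_ge0.
Qed.

End one_block.

Lemma block_comp V W V' W' h : bounded_op W' -> (forall h, P (W' h) = W' (P h)) ->
  block V W (block V' W' h) = block (V \o V') (W \o W') h.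
Proof.
by move=> bW' WP'; rewrite {1}/block (q_block _ bW' WP') (block_sub _ bW' WP').
Qed.

Lemma block_id h : block id id h = h.
Proof. by rewrite /block qE addrC subrK. Qed.

Lemma block_adj V (s : R) : bounded_op V ->
  adj (block V (fun h => toC s *: h)) = block (adj V) (fun h => toC s *: h).
Proof.
move=> bV; have bs : bounded_op (fun h : H => toC s *: h).
  exact: (bounded_scale _ bounded_id).
have Ps h : P (toC s *: h) = toC s *: P h by rewrite (linZ lP).
apply: adj_unique; first exact: block_bounded.
move=> h k; rewrite inner_block// -[RHS]inner_conj inner_block//.
rewrite rmorphD /= !inner_conj innerZr innerZl conj_toC.
by rewrite (adjP bV).2.
Qed.

End block_operators.

(** * Compressing a C*-extreme measure *)

Section compression.
Context {d : measure_display} {X : measurableType d} {R : realType}.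
Context {H : hilbertType R} {mu : set X -> H -> H}.
Variable Y : set X.
Hypotheses (mY : measurable Y) (idY : forall h, mu Y (mu Y h) = mu Y h).
Context (S : closed_subspace H) (q : H -> csub S).
Hypotheses (qE : forall h, incl (q h) = mu Y h).
Hypothesis (PS : forall x : csub S, mu Y (incl x) = incl x).

Let nu A := compress q (mu A).

Lemma compress_povm : normalized_povm mu -> normalized_povm nu.
Proof.
move=> [mu_povm mu1]; have bP := (mu_povm.1 Y mY).1.
have sP := povm_selfadj mu_povm mY.
split; first split.
- move=> A mA; split.
    by apply: (compress_bounded bP sP idY qE); exact: (mu_povm.1 A mA).1.
  move=> x; rewrite (inner_compress sP qE PS).
  exact: (povm_positive mu_povm mA).
- move=> x y; apply: cmeasure_ext (mu_povm.2 (incl x) (incl y)) => A mA.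
  by rewrite (inner_compress sP qE PS).
- by apply/funext => x; rewrite /nu /compress mu1 (qK qE PS).
Qed.

(** A C*-convex combination [la], [T] giving the compression is completed to
one giving [mu]: add to each [la i] the part of [mu] on the kernel of [mu Y],
and to each [T i] the scalar [s] whose square is the inverse of the number of
terms. The measures [la i] vanish outside [Y], because the compression does and
the [T i] are invertible, so the completed measures take the value [mu Y] at
[Y]; hence the unitaries commute with [mu Y] and compress to unitaries. *)
Lemma compress_extreme : Cstar_extreme mu -> Cstar_extreme nu.
Proof.
move=> [[mu_povm mu1] mu_ext]; split; first exact: compress_povm.
have bP := (mu_povm.1 Y mY).1; have lP := bounded_linear bP.
have sP := povm_selfadj mu_povm mY.
case=> [|m] la T la_norm invT sumT nuE; first by exists (fun=> id) => -[].
set n := m.+1 in la T la_norm invT sumT nuE *.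
pose s : R := (Num.sqrt n%:R)^-1.
have s2n : s ^+ 2 * n%:R = 1 by rewrite exprVn sqr_sqrtr// mulVf// pnatr_eq0.
have s0 : s != 0.
  apply: contra_eq_neq s2n => ->.
  by rewrite expr0n mul0r eq_sym oner_eq0.
pose sc (r : R) (h : H) := toC r *: h.
have bsc r : bounded_op (sc r) by exact: (bounded_scale _ (bounded_id)).
have Psc r h : mu Y (sc r h) = sc r (mu Y h) by rewrite /sc (linZ lP).
have Pmu A h : measurable A -> mu Y (mu A h) = mu A (mu Y h).
  by move=> mA; exact: povm_comm.
pose B (V : csub S -> csub S) W := block (mu Y) q V W.
pose la' i A := B (la i A) (mu A).
pose T' i := B (T i) (sc s).
have bla i A : measurable A -> bounded_op (la i A).
  by move=> mA; exact: ((la_norm i).1.1 A mA).1.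
have bmu A : measurable A -> bounded_op (mu A).
  by move=> mA; exact: (mu_povm.1 A mA).1.
have la'_norm i : normalized_povm (la' i).
  split; first split.
  - move=> A mA; split.
      by apply: (block_bounded bP sP idY qE) => //; [exact: bla|exact: bmu].
    move=> h; rewrite (inner_block bP sP idY qE PS)//;
      [|exact: bmu|by move=> ?; exact: Pmu].
    apply: addr_ge0; last exact: (povm_positive mu_povm mA).
    exact: (povm_positive (la_norm i).1 mA).
  - move=> h k; apply: (cmeasure_ext (m := fun A => inner (q h) (la i A (q k)) +
      inner (h - mu Y h) (mu A (k - mu Y k)))).
      move=> A mA; rewrite (inner_block bP sP idY qE PS)//; first exact: bmu.
      by move=> ?; exact: Pmu.
    have c1 := (la_norm i).1.2 (q h) (q k).
    have c2 := mu_povm.2 (h - mu Y h) (k - mu Y k).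
    exact: (cmeasure_add c1 c2).
  - apply/funext => h; rewrite /la' /B (la_norm i).2 mu1.
    exact: block_id.
have invT' i : invertible (T' i).
  have [bTi [Si [bSi ST TS]]] := invT i.
  split; first exact: (block_bounded bP sP idY qE).
  exists (B Si (sc s^-1)); split; first exact: (block_bounded bP sP idY qE).
  - apply/funext => h; rewrite /= /T' /B (block_comp bP idY qE PS)//.
    rewrite ST -[RHS](block_id qE); congr (block _ _ _ _ _); apply/funext => k.
    by rewrite /= /sc scalerA -rmorphM mulVf// scale1r.
  - apply/funext => h; rewrite /= /T' /B (block_comp bP idY qE PS)//.
    rewrite TS -[RHS](block_id qE); congr (block _ _ _ _ _); apply/funext => k.
    by rewrite /= /sc scalerA -rmorphM mulfV// scale1r.
have adjT' i : adj (T' i) = B (adj (T i)) (sc s).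
  by apply: (block_adj bP sP idY qE PS); exact: (invT i).1.
have sum_block (F : 'I_n -> csub S) (k : H) :
    \sum_(i < n) (incl (F i) + toC (s ^+ 2) *: k) = incl (\sum_(i < n) F i) + k.
  rewrite big_split /= sumr_const card_ord scalerMnl -rmorphMn -mulr_natr s2n.
  rewrite rmorph1 scale1r; congr (_ + _).
  by apply/esym; apply: (big_morph (@Defs.incl R H S)).
have [//|//|h|A mA h|U UP] := mu_ext n la' T'.
- transitivity (\sum_(i < n) (incl (adj (T i) (T i (q h))) +
      toC (s ^+ 2) *: (h - mu Y h))).
    apply: eq_bigr => i _; rewrite adjT' /T' /B (block_comp bP idY qE PS)//.
    by rewrite /block /= /sc scalerA -rmorphM.
  by rewrite sum_block sumT qE addrC subrK.
- transitivity (\sum_(i < n) (incl (adj (T i) (la i A (T i (q h)))) +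
      toC (s ^+ 2) *: mu A (h - mu Y h))); last first.
    apply: eq_bigr => i _; rewrite adjT' /T' /la' /B.
    have lA := bounded_linear (bmu A mA).
    rewrite (block_comp bP idY qE PS)//; [|exact: bmu|by move=> ?; exact: Pmu].
    rewrite (block_comp bP idY qE PS)//.
    by rewrite /block /= /sc (linZ lA) scalerA -rmorphM.
  rewrite sum_block -nuE// /nu /compress qE qE Pmu// idY.
  by rewrite (linB (bounded_linear (bmu A mA))) addrC subrK.
have null i x : la i (~` Y) x = 0.
  have mYC := measurableC mY.
  have [_ [Si [_ _ TS]]] := invT i.
  have -> : x = T i (Si x) by rewrite -[LHS]/(id x) -TS.
  set z := Si x.
  apply: positive_eq0.
  - exact: povm_linear (la_norm i).1 _ mYC.
  - exact: (povm_positive (la_norm i).1 mYC).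
  have sum0 : \sum_(j < n) rdot (T j z) (la j (~` Y) (T j z)) = 0.
    have nu0 : nu (~` Y) z = 0.
      apply: incl_inj; rewrite /nu /compress qE (povmC mu_povm mu1)// PS subrr.
      exact: lin0.
    have : rdot z (nu (~` Y) z) = 0 by rewrite nu0 rdot0r.
    rewrite nuE// /rdot inner_sumr (big_morph (@Re R) (@ReD R) (Re0 (R := R))).
    move=> sum0; rewrite -[RHS]sum0; apply: eq_bigr => j _.
    by rewrite (adj_inner _ _ (invT j).1).
  have /(_ _ sum0) := @psumr_eq0P _ _ xpredT
    (fun j => rdot (T j z) (la j (~` Y) (T j z))).
  apply=> // j _; apply: rdot_ge0; exact: (povm_positive (la_norm j).1 mYC).
have laY i x : la i Y x = x.
  by have := null i x; rewrite (povmC (la_norm i).1 (la_norm i).2)// => /eqP;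
    rewrite subr_eq0 eq_sym => /eqP.
exists (fun i => compress q (U i)) => i.
have [uU laU] := UP i; have [bU UU UV] := uU; have [UK KU] := unitaryK uU.
have [baU _] := adjP bU.
have PU h : mu Y (U i h) = U i (mu Y h).
  have /(congr1 (fun f => f h)) := laU Y mY.
  rewrite /la' /B /block laY (linB lP) idY subrr addr0 qE /= => ->.
  by rewrite KU.
have PaU h : mu Y (adj (U i) h) = adj (U i) (mu Y h).
  by rewrite -[in RHS](KU h) PU UK.
have adjU : adj (compress q (U i)) = compress q (adj (U i)).
  exact: (compress_adj bP sP idY qE PS).
split.
  split; first exact: (compress_bounded bP sP idY qE).
  - apply/funext => x; rewrite adjU /= /compress qE PU PS UK.
    exact: (qK qE PS).
  - apply/funext => x; rewrite adjU /= /compress qE PaU PS KU.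
    exact: (qK qE PS).
move=> A mA; apply/funext => x; apply: incl_inj; rewrite adjU /=.
rewrite -(block_incl qE PS (la i A) (bmu A mA)) -/(B _ _) -/(la' i A) laU//=.
by rewrite /nu /compress !qE PU PS Pmu// PU PS PaU Pmu// PU PS.
Qed.

End compression.

(** * The part of the space carrying the atoms *)

Section atoms.
Context {d : measure_display} {X : measurableType d} {R : realType}.
Context {H : hilbertType R} {mu : set X -> H -> H}.
Hypotheses (mu_povm : povm mu) (mu1 : mu setT = id).

(** Applying [mu] of the union to the value at one member changes nothing, so
the scalar series computing [mu] of the union and its square coincide. *)
Lemma povm_idem_bigcup (B : (set X)^nat) : (forall n, measurable (B n)) ->
  trivIset setT B -> (forall n h, mu (B n) (mu (B n) h) = mu (B n) h) ->
  forall h, mu (\bigcup_n B n) (mu (\bigcup_n B n) h) = mu (\bigcup_n B n) h.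
Proof.
move=> mB tB idB k; set C := \bigcup_n B n.
have mC : measurable C by exact: bigcup_measurable.
apply: inner_ext => h; rewrite (povm_selfadj mu_povm mC).
apply: limit_unique (mu_povm.2 (mu C h) k B mB tB) _.
rewrite (_ : (fun n => _) = (fun n => \sum_(i < n) inner h (mu (B i) k) : R[i]^o)).
  exact: (mu_povm.2 h k B mB tB).
apply/funext => n; apply: eq_bigr => i _; rewrite -(povm_selfadj mu_povm mC).
by rewrite (povm_idem_sub mu_povm mu1)//; exact: bigcup_sup.
Qed.

Lemma atom_sub A B : atom mu A -> measurable B -> B `<=` A -> mu B = mu A ->
  atom mu B.
Proof.
move=> [mA A0 A01] mB BA BE; split=> //; first by rewrite BE.
by move=> C mC CB; rewrite BE; apply: A01 => //; exact: subset_trans BA.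
Qed.

Hypothesis atom_idem : forall A, atom mu A -> forall h, mu A (mu A h) = mu A h.
Hypothesis sepH : separable_space H.

(** Two atoms with different values meet in a null set, so their values are
orthogonal projections; take one vector in each range. *)
Lemma countable_atom_values :
  countable [set P : H -> H | exists2 A, atom mu A & mu A = P].
Proof.
set F := [set P | _].
have [e eP] : exists e : (H -> H) -> H, forall P, F P -> e P <> 0 /\ P (e P) = e P.
  suff /choice[e eP] : forall P, exists h : H, F P -> h <> 0 /\ P h = h by exists e.
  move=> P; have [[A aA <-]|nF] := pselect (F P); last by exists 0.
  have [_ A0 _] := aA; have [h hA] : exists h, mu A h <> 0.
    by apply/not_existsP => A0'; apply: A0; apply/funext => h;
      apply: contrapT; exact: A0'.
  by exists (mu A h) => _; split=> //; exact: atom_idem.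
apply: (countable_orthogonal sepH (e := e)) => [P /eP[]//|P Q FP FQ PQ].
have [_ <-] := eP _ FP; have [_ <-] := eP _ FQ.
case: FP => A aA AP; case: FQ => B aB BQ; rewrite -AP -BQ in PQ *.
have [mA _ A01] := aA; have [mB _ B01] := aB.
have mBA := measurableI _ _ mB mA.
rewrite rdotC -(rdot_selfadj (povm_selfadj mu_povm mB)) -(povm_capE mu_povm mu1 mA)//;
  last exact: atom_idem.
have [->|BA_A] := A01 _ mBA (@subIsetr _ _ _); first by rewrite rdot0r.
have [->|BA_B] := B01 _ mBA (@subIsetl _ _ _); first by rewrite rdot0r.
by case: PQ; rewrite -BA_A.
Qed.

Lemma exhausting_atoms : exists A : (set X)^nat,
  (forall n, A n = set0 \/ atom mu (A n)) /\
  forall B, atom mu B -> exists n, mu (A n) = mu B.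
Proof.
have /countable_injP[g g_inj] := countable_atom_values.
have /choice[A AP] : forall n, exists C, (C = set0 \/ atom mu C) /\
    forall B, atom mu B -> g (mu B) = n -> mu C = mu B.
  move=> n; have [[C [aC gC]]|nC] := pselect (exists C, atom mu C /\ g (mu C) = n).
    exists C; split; first by right.
    move=> B aB gB; apply: g_inj; last by rewrite gC gB.
      by apply: mem_set; exists C.
    by apply: mem_set; exists B.
  exists set0; split; first by left.
  by move=> B aB gB; case: nC; exists B.
exists A; split=> [n|B aB]; first exact: (AP n).1.
by exists (g (mu B)); apply: (AP _).2.
Qed.

(** The property of the set that supports the atomic summand; it is stated
for [mu] alone, which is what makes that set comparable between two
decompositions. *)
Definition carries_atoms (Y : set X) := [/\ measurable Y,
  forall A, measurable A -> A `<=` Y -> mu A <> (fun=> 0) ->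
    exists2 B, B `<=` A & atom mu B &
  forall A, A `<=` ~` Y -> ~ atom mu A].

(** The union of the representatives. Inside it a non-null set meets one of the
representatives in an atom; outside it an atom would have the same value as a
representative disjoint from it, yet these values annihilate each other. *)
Lemma carries_atoms_exists : exists2 Y, carries_atoms Y &
  forall B h, measurable B -> B `<=` Y -> mu B (mu B h) = mu B h.
Proof.
have [A [aA exA]] := exhausting_atoms.
have mA n : measurable (A n) by case: (aA n) => [->|[]].
have mY : measurable (\bigcup_n A n) by exact: bigcup_measurable.
have A01 n B : measurable B -> B `<=` A n -> mu B = (fun=> 0) \/ mu B = mu (A n).
  move=> mB BA; case: (aA n) => [A0|[_ _]]; last exact.
  by left; move: BA; rewrite A0 subset0 => ->; exact: povm0.
have idA n h : mu (A n) (mu (A n) h) = mu (A n) h.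
  case: (aA n) => [->|/atom_idem//]; by rewrite (povm0 mu_povm).
exists (\bigcup_n A n); first split=> //.
- move=> B mB BY B0; have [n Bn] : exists n, mu (B `&` A n) <> (fun=> 0).
    apply/not_existsP => nB; apply: B0; apply/funext => h.
    have -> : B = \bigcup_n (B `&` A n).
      by rewrite -setI_bigcupr; apply/esym/setIidPl.
    apply: (povm_null_bigcup mu_povm) => n; first exact: measurableI.
    by rewrite (contrapT (nB n)).
  have mBn := measurableI _ _ mB (mA n).
  exists (B `&` A n); first exact: subIsetl.
  have [//|BA] := A01 n _ mBn (@subIsetr _ _ _).
  case: (aA n) => [A0|an]; last exact: (atom_sub an mBn (@subIsetr _ _ _)).
  by case: Bn; rewrite A0 setI0 (povm0 mu_povm).
- move=> B BY aB; have [n An] := exA _ aB; have [mB B0 _] := aB.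
  apply: B0; apply/funext => h; rewrite -(atom_idem aB) -An.
  rewrite -[mu (A n) h]idA {1}An; apply: (povm_idem_disj mu_povm mu1 (mA n)) => //.
  apply/seteqP; split=> // x [Ax /BY Yx]; apply: Yx; by exists n.
move=> B h mB BY.
have mD := seqDU_measurable mA.
have -> : B = \bigcup_n (B `&` seqDU A n).
  by rewrite -setI_bigcupr -seqDU_bigcup_eq; apply/esym/setIidPl.
apply: povm_idem_bigcup => [n||n k]; first exact: measurableI.
  by apply: trivIset_setIl; exact: trivIset_seqDU.
have [||->|->] := A01 n (B `&` seqDU A n).
- exact: measurableI.
- by apply: subset_trans (@subset_seqDU _ _ _); exact: subIsetr.
- by [].
- exact: idA.
Qed.

End atoms.

(** * The decomposition *)

Section transfer.
Context {d : measure_display} {X : measurableType d} {R : realType}.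

(** Being an atom below [Z] depends only on which subsets of [Z] have equal
values, since null sets are those with the value of the empty set; this
transfers atoms between [mu] and its summands in both directions. *)
Definition same_values_on {H K : hilbertType R} (mu : set X -> H -> H)
    (nu : set X -> K -> K) (Z : set X) :=
  forall A B, measurable A -> measurable B -> A `<=` Z -> B `<=` Z ->
    mu A = mu B <-> nu A = nu B.

Lemma same_values_sym {H K : hilbertType R} (mu : set X -> H -> H)
    (nu : set X -> K -> K) (Z : set X) :
  same_values_on mu nu Z -> same_values_on nu mu Z.
Proof. by move=> mn A B mA mB AZ BZ; split=> /mn; apply. Qed.

Context {H K : hilbertType R} {mu : set X -> H -> H} {nu : set X -> K -> K}.
Context {Z : set X}.
Hypotheses (mu_povm : povm mu) (nu_povm : povm nu).
Hypothesis mn : same_values_on mu nu Z.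

Lemma same_values_null A : measurable A -> A `<=` Z ->
  mu A = (fun=> 0) <-> nu A = (fun=> 0).
Proof.
move=> mA AZ; rewrite -(povm0 mu_povm) -(povm0 nu_povm).
by apply: mn => //; exact: measurable0.
Qed.

Lemma same_values_atom A : A `<=` Z -> atom mu A -> atom nu A.
Proof.
move=> AZ [mA A0 A01]; split=> //.
  by move=> nA0; apply: A0; apply/(same_values_null mA AZ).
move=> B mB BA; have BZ := subset_trans BA AZ.
case: (A01 B mB BA) => [B0|BE]; first by left; apply/(same_values_null mB BZ).
by right; apply/(mn mB mA BZ AZ).
Qed.

End transfer.

Section concentration.
Context {d : measure_display} {X : measurableType d} {R : realType}.
Context {H : hilbertType R} {mu : set X -> H -> H}.

Lemma atom_concentrated (Z A : set X) : measurable Z ->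
  (forall B, measurable B -> mu B = mu (B `&` Z)) ->
  atom mu A -> atom mu (A `&` Z).
Proof.
move=> mZ muZ aA; have [mA _ _] := aA; apply: (atom_sub aA).
- exact: measurableI.
- exact: subIsetl.
- by rewrite -muZ.
Qed.

(** A non-null difference would contain an atom lying outside the other set. *)
Lemma carries_atoms_unique (Y Y' : set X) : povm mu ->
  carries_atoms (mu := mu) Y -> carries_atoms (mu := mu) Y' -> mu Y = mu Y'.
Proof.
move=> mu_povm; suff diff Z Z' : carries_atoms (mu := mu) Z ->
    carries_atoms (mu := mu) Z' -> forall h, mu (Z `\` Z') h = 0.
  move=> cY cY'; have [mY _ _] := cY; have [mY' _ _] := cY'.
  apply/funext => h; rewrite (povmID mu_povm h mY mY') (povmID mu_povm h mY' mY).
  by rewrite diff// diff// setIC.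
move=> [mZ exZ _] [mZ' _ noZ'] h.
suff -> : mu (Z `\` Z') = (fun=> 0) by [].
apply: contrapT => D0; have mD := measurableD mZ mZ'.
have [B BD aB] := exZ _ mD (@subDsetl _ _ _) D0.
by apply: (noZ' B) aB => x /BD[].
Qed.

End concentration.

Section decomposition.
Context {d : measure_display} {X : measurableType d} {R : realType}.
Context {H : hilbertType R} {mu : set X -> H -> H}.
Hypotheses (mu_povm : povm mu) (mu1 : mu setT = id).

Section compress.
Variable Z : set X.
Hypotheses (mZ : measurable Z) (idZ : forall h, mu Z (mu Z h) = mu Z h).
Context (S : closed_subspace H) (q : H -> csub S).
Hypotheses (qE : forall h, incl (q h) = mu Z h).
Hypothesis (PS : forall x : csub S, mu Z (incl x) = incl x).

Let nu A := compress q (mu A).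

Lemma incl_compress A x : measurable A -> incl (nu A x) = mu A (incl x).
Proof. by move=> mA; rewrite /nu /compress qE (povm_comm mu_povm mu1)// PS. Qed.

Lemma compress_capE A : measurable A -> nu A = nu (A `&` Z).
Proof.
move=> mA; apply/funext => x; apply: incl_inj; rewrite !incl_compress//.
  by rewrite (povm_capE mu_povm mu1)// PS.
exact: measurableI.
Qed.

Lemma compress_same_values : same_values_on mu nu Z.
Proof.
move=> A B mA mB AZ BZ; split=> [AB|nAB]; first by rewrite /nu AB.
have inZ C h : measurable C -> C `<=` Z -> mu C h = mu C (mu Z h).
  move=> mC CZ; rewrite -(povm_capE mu_povm mu1)//.
  by congr (mu _ h); apply/esym/setIidPl.
by apply/funext => h; rewrite (inZ A)// (inZ B)// -qE -!incl_compress// nAB.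
Qed.

End compress.

Lemma range_decomposition (Y : set X) : carries_atoms (mu := mu) Y ->
  (forall h, mu Y (mu Y h) = mu Y h) ->
  exists (H1 H2 : closed_subspace H) (q1 : H -> csub H1) (q2 : H -> csub H2),
    [/\ forall h, incl (q1 h) = mu Y h,
        forall x : csub H1, mu Y (incl x) = incl x,
        forall h, incl (q2 h) = mu (~` Y) h,
        forall x : csub H2, mu (~` Y) (incl x) = incl x &
        atomic_nonatomic_decomposition mu
          (fun A => compress q1 (mu A)) (fun A => compress q2 (mu A))].
Proof.
move=> [mY exY noY] idY; have mYC := measurableC mY.
have idYC h : mu (~` Y) (mu (~` Y) h) = mu (~` Y) h.
  rewrite !(povmC mu_povm mu1)//.
  by rewrite (linB (povm_linear mu_povm mY)) idY subrr subr0.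
have bY := (mu_povm.1 Y mY).1; have bYC := (mu_povm.1 _ mYC).1.
have sY := povm_selfadj mu_povm mY; have sYC := povm_selfadj mu_povm mYC.
pose H1 := range_space bY sY idY; pose H2 := range_space bYC sYC idYC.
pose q1 : H -> csub H1 := to_range bY sY idY.
pose q2 : H -> csub H2 := to_range bYC sYC idYC.
have q1E h : incl (q1 h) = mu Y h by [].
have q2E h : incl (q2 h) = mu (~` Y) h by [].
have P1 (x : csub H1) : mu Y (incl x) = incl x by exact: range_incl.
have P2 (x : csub H2) : mu (~` Y) (incl x) = incl x by exact: range_incl.
have mu_norm : normalized_povm mu by split.
have n1 : normalized_povm (fun A => compress q1 (mu A)).
  exact: (compress_povm mY idY q1E P1 mu_norm).
have n2 : normalized_povm (fun A => compress q2 (mu A)).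
  exact: (compress_povm mYC idYC q2E P2 mu_norm).
have s1 := compress_same_values mY idY q1E P1.
have s2 := compress_same_values mYC idYC q2E P2.
have c1 A := compress_capE mY idY q1E P1 (A := A).
have c2 A := compress_capE mYC idYC q2E P2 (A := A).
exists H1, H2, q1, q2; split=> //; split.
- split=> [h1 h2|h].
    rewrite -P1 -P2 -sY (povmC mu_povm mu1)// (linB bY.1) idY subrr.
    by rewrite inner0r.
  by exists (q1 h), (q2 h); rewrite q1E q2E (povmC mu_povm mu1)// addrC subrK.
- move=> A mA h1 h2; rewrite (incl_compress mY idY q1E P1)//.
  rewrite (incl_compress mYC idYC q2E P2)//.
  by rewrite (linD (povm_linear mu_povm mA)).
- split=> // A mA A0.
  have mAY := measurableI _ _ mA mY.
  have [|||B BA aB] := exY (A `&` Y) => //.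
    move=> AY0; apply: A0; rewrite c1//.
    apply: (same_values_null mu_povm n1.1 s1 mAY _).1 AY0; exact: subIsetr.
  exists B; first by move=> x /BA[].
  by apply: (same_values_atom mu_povm n1.1 s1) aB => x /BA[].
- split=> // A aA.
  have aAY := atom_concentrated mYC c2 aA.
  apply: (noY _ (@subIsetr _ A (~` Y))).
  apply: (same_values_atom n2.1 mu_povm (same_values_sym s2)) aAY.
  exact: subIsetr.
- exists Y, (~` Y); split=> //; first by rewrite setICr.
  by move=> A mA; split; [exact: c1|exact: c2].
Qed.

(** The set [Y] is the one on which the first summand lives: there the second
summand vanishes, so [mu Y] is the projection onto the first subspace, and
atoms of [mu] inside [Y] are atoms of the first summand, while an atom outside
[Y] yields one of the second. *)
Lemma decomposition_carrier (K1 K2 : closed_subspace H)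
    (nu1 : set X -> csub K1 -> csub K1) (nu2 : set X -> csub K2 -> csub K2) :
  atomic_nonatomic_decomposition mu nu1 nu2 ->
  exists Y, [/\ carries_atoms (mu := mu) Y,
    carrier K1 = [set h | mu Y h = h], carrier K2 = [set h | mu Y h = 0],
    forall A x, measurable A -> incl (nu1 A x) = mu A (incl x) &
    forall A x, measurable A -> incl (nu2 A x) = mu A (incl x)].
Proof.
move=> [[orth span] sum [[p1 T1] at1] [[p2 T2] at2] [Y1 [Y2 [mY1 mY2 Y12 conc]]]].
have conc1 A mA := (conc A mA).1; have conc2 A mA := (conc A mA).2.
have nu1E A x : measurable A -> incl (nu1 A x) = mu A (incl x).
  move=> mA; have := sum A mA x 0.
  by rewrite (lin0 (povm_linear p2 mA)) incl0 !addr0 => ->.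
have nu2E A x : measurable A -> incl (nu2 A x) = mu A (incl x).
  move=> mA; have := sum A mA 0 x.
  by rewrite (lin0 (povm_linear p1 mA)) incl0 !add0r => ->.
have nu1_0 A : measurable A -> A `<=` Y2 -> nu1 A = (fun=> 0).
  move=> mA AY; rewrite conc1// (_ : A `&` Y1 = set0) ?(povm0 p1)//.
  by apply/seteqP; split=> // x [/AY y2 y1]; rewrite -[set0]Y12.
have nu2_0 A : measurable A -> A `<=` Y1 -> nu2 A = (fun=> 0).
  move=> mA AY; rewrite conc2// (_ : A `&` Y2 = set0) ?(povm0 p2)//.
  by apply/seteqP; split=> // x [/AY y2 y1]; rewrite -[set0]Y12.
have s1 : same_values_on mu nu1 Y1.
  move=> A B mA mB AY BY; split=> [AB|AB].
    by apply/funext => x; apply: incl_inj; rewrite !nu1E// AB.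
  apply/funext => h; have [h1 [h2 ->]] := span h.
  by rewrite !sum// AB !nu2_0.
have s2 : same_values_on mu nu2 Y2.
  move=> A B mA mB AY BY; split=> [AB|AB].
    by apply/funext => x; apply: incl_inj; rewrite !nu2E// AB.
  apply/funext => h; have [h1 [h2 ->]] := span h.
  by rewrite !sum// AB !nu1_0.
have muY1 (h1 : csub K1) (h2 : csub K2) : mu Y1 (incl h1 + incl h2) = incl h1.
  rewrite sum// nu2_0// incl0 addr0 -[Y1]setTI -conc1// T1//.
exists Y1; split=> //; first split=> //.
- move=> A mA AY A0; have [|B BA aB] := at1 A mA.
    by move=> nA0; apply: A0; apply/(same_values_null mu_povm p1 s1).
  exists B => //; apply: (same_values_atom p1 mu_povm (same_values_sym s1)) aB.
  exact: subset_trans AY.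
- move=> A AY aA; have [mA _ _] := aA.
  have muA B : measurable B -> B `<=` ~` Y1 -> mu B = mu (B `&` Y2).
    move=> mB BY; have mBY2 := measurableI _ _ mB mY2.
    apply/funext => h; have [h1 [h2 ->]] := span h.
    rewrite !sum// -conc2//; congr (incl _ + _).
    rewrite (nu1_0 _ mBY2 (@subIsetr _ _ _)).
    rewrite conc1// (_ : B `&` Y1 = set0) ?(povm0 p1)//.
    by apply/seteqP; split=> // x [/BY].
  have aAY2 : atom mu (A `&` Y2).
    apply: (atom_sub aA); [exact: measurableI|exact: subIsetl|].
    by rewrite -muA.
  apply: (at2 (A `&` Y2)); apply: (same_values_atom mu_povm p2 s2) aAY2.
  exact: subIsetr.
- apply/seteqP; split=> h /=.
    move=> K1h; have K1h' : in_csub K1 h by rewrite /in_csub inE.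
    by have := muY1 (Csub K1h') 0; rewrite incl0 addr0.
  have [h1 [h2 ->]] := span h; rewrite muY1 => <-.
  by have := incl_in h1; rewrite /in_csub inE.
- apply/seteqP; split=> h /=.
    move=> K2h; have K2h' : in_csub K2 h by rewrite /in_csub inE.
    by have := muY1 0 (Csub K2h'); rewrite incl0 add0r.
  have [h1 [h2 ->]] := span h; rewrite muY1 => ->; rewrite add0r.
  by have := incl_in h2; rewrite /in_csub inE.
Qed.

Lemma decomposition_unique (K1 K2 L1 L2 : closed_subspace H)
    (nu1 : set X -> csub K1 -> csub K1) (nu2 : set X -> csub K2 -> csub K2)
    (la1 : set X -> csub L1 -> csub L1) (la2 : set X -> csub L2 -> csub L2) :
  atomic_nonatomic_decomposition mu nu1 nu2 ->
  atomic_nonatomic_decomposition mu la1 la2 ->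
  same_povm nu1 la1 /\ same_povm nu2 la2.
Proof.
move=> /decomposition_carrier[Y [cY K1E K2E nu1E nu2E]].
move=> /decomposition_carrier[Z [cZ L1E L2E la1E la2E]].
have YZ := carries_atoms_unique mu_povm cY cZ.
split; split=> [|A mA h k hk].
- by rewrite K1E L1E YZ.
- by rewrite nu1E// la1E// hk.
- by rewrite K2E L2E YZ.
- by rewrite nu2E// la2E// hk.
Qed.

End decomposition.

Theorem theorem4p9 (R : realType) (d : measure_display) (X : measurableType d)
    (H : hilbertType R) (mu : set X -> H -> H)
    (measurable_singleton : forall x : X, measurable [set x])
    (separableH : separable_space H)
    (extreme_mu : Cstar_extreme mu) :
  exists (H1 H2 : closed_subspace H)
    (mu1 : set X -> csub H1 -> csub H1) (mu2 : set X -> csub H2 -> csub H2),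
    [/\ atomic_nonatomic_decomposition mu mu1 mu2,
        (forall (K1 K2 : closed_subspace H)
            (nu1 : set X -> csub K1 -> csub K1)
            (nu2 : set X -> csub K2 -> csub K2),
          atomic_nonatomic_decomposition mu nu1 nu2 ->
          same_povm mu1 nu1 /\ same_povm mu2 nu2),
        Cstar_extreme mu1,
        Cstar_extreme mu2 &
        spectral_measure mu1].
Proof.
have [[mu_povm mu1] _] := extreme_mu.
have atom_idem A : atom mu A -> forall h, mu A (mu A h) = mu A h.
  exact: extreme_atom_idem.
have [Y cY idY] := carries_atoms_exists mu_povm mu1 atom_idem separableH.
have [mY _ _] := cY; have mYC := measurableC mY.
have idYY h : mu Y (mu Y h) = mu Y h by exact: idY.
have idYC h : mu (~` Y) (mu (~` Y) h) = mu (~` Y) h.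
  rewrite !(povmC mu_povm mu1)//.
  by rewrite (linB (povm_linear mu_povm mY)) idYY subrr subr0.
have [H1 [H2 [q1 [q2 [q1E P1 q2E P2 dec]]]]] :=
  range_decomposition mu_povm mu1 cY idYY.
have ext1 := compress_extreme mY idYY q1E P1 extreme_mu.
exists H1, H2, (fun A => compress q1 (mu A)), (fun A => compress q2 (mu A)).
split=> //.
- by move=> K1 K2 nu1 nu2; exact: decomposition_unique.
- exact: (compress_extreme mYC idYC q2E P2 extreme_mu).
split; first exact: ext1.1.
move=> A mA; have bA := (ext1.1.1.1 A mA).1; split=> //.
  by apply: selfadj_adj => //; exact: (povm_selfadj ext1.1.1).
apply/funext => x; apply: incl_inj; rewrite /=.
have mAY := measurableI _ _ mA mY.
have capE h := povm_capE mu_povm mu1 mY idYY h mA.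
have nuE y := incl_compress mu_povm mu1 mY idYY q1E P1 y mA.
rewrite nuE -{1}P1 -capE nuE -[in LHS](P1 x) -capE (idY _ _ mAY (@subIsetr _ _ _)).
by rewrite capE P1.
Qed.
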